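(* Let $\mathcal K$ be the category whose objects are the core graphs of groups and whose arrows are the immersions between them, taken up to $\approx$-equivalence. If $\mathbb A$ is an acylindrical graph of groups (an object of $\mathcal K$), then any two arrows $\mu^B\colon\mathbb B\to\mathbb A$ and $\mu^C\colon\mathbb C\to\mathbb A$ of $\mathcal K$ have a pullback in $\mathcal K$.
   Context: **Conventions.** For group elements, $x^g=g^{-1}xg$ and $\gamma_g(x)=x^g$. A graph $\mathsf A$ has a vertex set $V(\mathsf A)$, an edge set $E(\mathsf A)$, maps $o,t\colon E(\mathsf A)\to V(\mathsf A)$ and a fixed-point-free involution $e\mapsto e^{-1}$ on edges with $t(e^{-1})=o(e)$; graph morphisms preserve this structure. Graphs need not be connected and may be empty. **Graphs of groups.** A graph of groups $\mathbb A$ consists of a graph $\mathsf A$, vertex groups $A_u$, edge groups $A_e=A_{e^{-1}}$, and monomorphisms $\alpha_e\colon A_e\to A_{o(e)}$, $\omega_e\colon A_e\to A_{t(e)}$ with $\omega_e=\alpha_{e^{-1}}$. **Paths.** An $\mathbb A$-path of length $k$ is a sequence $p=(a_0,e_1,a_1,\dots,e_k,a_k)$ where $(e_1,\dots,e_k)$ is a path in $\mathsf A$, $a_{i-1}\in A_{o(e_i)}$, $a_k\in A_{t(e_k)}$ (for $k=0$: $p=(a)$ with $a$ in a vertex group). Paths are concatenated by multiplying the adjacent group elements; $p^{-1}=(a_k^{-1},e_k^{-1},\dots,e_1^{-1},a_0^{-1})$; a circuit is a path with equal ends. The congruence $=_{\mathbb A}$ is generated by $(1,e,\omega_e(x),e^{-1},1)=_{\mathbb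 A}(\alpha_e(x))$, $x\in A_e$. A path is reduced if $a_i\notin\omega_{e_i}(A_{e_i})$ whenever $e_{i+1}=e_i^{-1}$; a circuit is cyclically reduced if it is reduced and, when $e_k=e_1^{-1}$, also $a_ka_0\notin\alpha_{e_1}(A_{e_1})$. **Core, acylindrical.** $\mathrm{core}(\mathbb A)$ is the graph of groups consisting of all vertices and edges of $\mathsf A$ (with the corresponding groups and maps) occurring in cyclically reduced $\mathbb A$-circuits of positive length; $\mathbb A$ is core if $\mathbb A=\mathrm{core}(\mathbb A)$. $\mathbb A$ is $k$-acylindrical if for every reduced $\mathbb A$-path $p$ of length $k$ and every non-trivial $a\in A_{t(p)}$, the path $p\,a\,p^{-1}$ is not $=_{\mathbb A}$-equal to an element of $A_{o(p)}$; it is acylindrical if it is $k$-acylindrical for some integer $k\ge0$. **Morphisms.** A morphism $\mu\colon\mathbb B\to\mathbb A$ consists of a graph morphism $\mathsf B\to\mathsf A$ (also written $\mu$), monomorphisms $\mu_v\colon B_v\to A_{\mu(v)}$ and $\mu_f\colon B_f\to A_{\mu(f)}$, and, for each edge $f$ of $\mathsf B$, twisting elements $f_\alpha\in A_{\mu(o(f))}$, $f_\omega\in A_{\mu(t(f))}$ with $(f^{-1})_\alpha=f_\omega$ and $(f^{-1})_\omega=f_\alpha$, such that with $e=\mu(f)$, $v=o(f)$, $v'=t(f)$: $\alpha_e\circ\mu_f=\gamma_{f_\alpha}\circ\mu_v\circ\alpha_f$ and $\omega_e\circ\mu_f=\gamma_{f_\omega}\circ\mu_{v'}\circ\omega_f$.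 Morphisms $\mu\colon\mathbb C\to\mathbb B$, $\nu\colon\mathbb B\to\mathbb A$ compose in the obvious way, the $\alpha$-twisting element of an edge $g$ under $\nu\circ\mu$ being $\nu(g_\alpha)\,\mu(g)_\alpha$. **Immersions.** $\mu$ is an immersion if (i) for edges $f,f'$ of $\mathsf B$ with common origin $v$ and common image $e$, $f=f'$ if and only if $\mu_v(B_v)f_\alpha\alpha_e(A_e)=\mu_v(B_v)f'_\alpha\alpha_e(A_e)$; and (ii) for every edge $f$ with $v=o(f)$, $e=\mu(f)$: $\alpha_e(\mu_f(B_f))=\mu_v(B_v)^{f_\alpha}\cap\alpha_e(A_e)$. **Equivalence.** Two morphisms $\mu^1,\mu^2\colon\mathbb B\to\mathbb A$ are $\approx$-equivalent if they agree on the underlying graph and there are elements $a_v\in A_{\mu^1(v)}$ ($v\in V(\mathsf B)$) and $a_f\in A_{\mu^1(f)}$ ($f\in E(\mathsf B)$) with $a_{f^{-1}}=a_f$, $\mu^2_v=\gamma_{a_v}\circ\mu^1_v$, and $a_v=f^1_\alpha\,\alpha_{\mu^1(f)}(a_f)\,(f^2_\alpha)^{-1}$ whenever $o(f)=v$, where $f^i_\alpha$ is the twisting element for $\mu^i$. **Pullback.** In a category, the pullback of $\mu^B\colon B\to A$ and $\mu^C\colon C\to A$ is an object $P$ with arrows $\rho^B\colon P\to B$, $\rho^C\colon P\to C$ such that $\mu^B\rho^B=\mu^C\rho^C$ and, for all $\sigma^B\colon P'\to B$, $\sigma^C\colon P'\to C$ with $\mu^B\sigma^B=\mu^C\sigma^C$,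 there is a unique $\sigma\colon P'\to P$ with $\rho^B\sigma=\sigma^B$, $\rho^C\sigma=\sigma^C$. *)

(* Defs.v *)
(* Possibly infinite groups are [groupType]s.  Their carriers are [choiceType]s,
   which is no restriction classically. *)
From HB Require Import structures.
From mathcomp Require Import all_boot.
From mathcomp Require Import boolp classical_sets.

Set Implicit Arguments.
Unset Strict Implicit.
Unset Printing Implicit Defensive.

Local Open Scope group_scope.
Local Open Scope classical_set_scope.

Notation ghom := UMagmaMorphism.type.

(** * Categories, with equality of arrows a specified equivalence *)

Record category := Category {
  obj :> Type;
  arrow : obj -> obj -> Type;
  arrow_eq : forall X Y, arrow X Y -> arrow X Y -> Prop;
  arrow_id : forall X, arrow X X;
  arrow_comp : forall X Y Z, arrow Y Z -> arrow X Y -> arrow X Z;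
  arrow_eq_refl : forall X Y (f : arrow X Y), arrow_eq f f;
  arrow_eq_sym : forall X Y (f g : arrow X Y), arrow_eq f g -> arrow_eq g f;
  arrow_eq_trans : forall X Y (f g h : arrow X Y),
    arrow_eq f g -> arrow_eq g h -> arrow_eq f h;
  arrow_comp_eq : forall X Y Z (g g' : arrow Y Z) (f f' : arrow X Y),
    arrow_eq g g' -> arrow_eq f f' ->
    arrow_eq (arrow_comp g f) (arrow_comp g' f');
  arrow_compA : forall W X Y Z
      (h : arrow Y Z) (g : arrow X Y) (f : arrow W X),
    arrow_eq (arrow_comp h (arrow_comp g f)) (arrow_comp (arrow_comp h g) f);
  arrow_comp1 : forall X Y (f : arrow X Y),
    arrow_eq (arrow_comp f (arrow_id X)) f;
  arrow_1comp : forall X Y (f : arrow X Y),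
    arrow_eq (arrow_comp (arrow_id Y) f) f }.

Record is_pullback (K : category) (A B C P : K)
    (muB : arrow B A) (muC : arrow C A) (rhoB : arrow P B) (rhoC : arrow P C)
    : Prop := IsPullback {
  pullback_comm : arrow_eq (arrow_comp muB rhoB) (arrow_comp muC rhoC);
  pullback_univ : forall (P' : K) (sigmaB : arrow P' B) (sigmaC : arrow P' C),
    arrow_eq (arrow_comp muB sigmaB) (arrow_comp muC sigmaC) ->
    exists sigma : arrow P' P,
      [/\ arrow_eq (arrow_comp rhoB sigma) sigmaB,
          arrow_eq (arrow_comp rhoC sigma) sigmaC &
          forall sigma' : arrow P' P,
            arrow_eq (arrow_comp rhoB sigma') sigmaB ->
            arrow_eq (arrow_comp rhoC sigma') sigmaC ->
            arrow_eq sigma' sigma] }.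

(** * Graphs *)

(* [edge u v] is the type of the edges e with o(e) = u and t(e) = v.  When
   u and v differ, e and its inverse are automatically distinct, so that
   [einv_neq] only concerns loops. *)
Record graph := Graph {
  vert :> Type;
  edge : vert -> vert -> Type;
  einv : forall u v, edge u v -> edge v u;
  einvK : forall u v (e : edge u v), einv (einv e) = e;
  einv_neq : forall u (e : edge u u), einv e <> e }.
Arguments edge {g} u v.
Arguments einv {g u v} e.

(* Edges with a prescribed origin, resp. terminus, and all edges; equality of
   edges with possibly different ends is stated in these types. *)
Definition outE (G : graph) (u : G) := {v : G & edge u v}.
Definition inE (G : graph) (v : G) := {u : G & edge u v}.
Definition allE (G : graph) := {u : G & outE u}.
Definition out (G : graph) (u v : G) (e : edge u v) : outE u :=
  existT (fun v => edge u v) v e.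
Definition inc (G : graph) (u v : G) (e : edge u v) : inE v :=
  existT (fun u => edge u v) u e.
Definition tot (G : graph) (u v : G) (e : edge u v) : allE G :=
  existT (@outE G) u (out e).

Record graph_mor (B A : graph) := GraphMor {
  vmap :> B -> A;
  emap : forall u v : B, edge u v -> edge (vmap u) (vmap v);
  emapV : forall (u v : B) (f : edge u v), emap (einv f) = einv (emap f) }.
Arguments emap {B A} g {u v} f.

(** * Graphs of groups *)

(* The equality A_e = A_(e^-1) is rendered by the identification [eflip]; the
   equations [alpha_flip] and [omega_flip] are omega_e = alpha_(e^-1) for e and
   for e^-1.  As alpha and omega are injective, they force [eflip] to be an
   involutive isomorphism. *)
Record gog := Gog {
  gr :> graph;
  VG : gr -> groupType;
  EG : forall u v : gr, edge u v -> groupType;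
  alpha : forall (u v : gr) (e : edge u v), ghom (EG e) (VG u);
  omega : forall (u v : gr) (e : edge u v), ghom (EG e) (VG v);
  alpha_inj : forall (u v : gr) (e : edge u v), injective (alpha e);
  omega_inj : forall (u v : gr) (e : edge u v), injective (omega e);
  eflip : forall (u v : gr) (e : edge u v), EG e -> EG (einv e);
  alpha_flip : forall (u v : gr) (e : edge u v) (x : EG e),
    alpha (einv e) (eflip x) = omega e x;
  omega_flip : forall (u v : gr) (e : edge u v) (x : EG e),
    omega (einv e) (eflip x) = alpha e x }.
Arguments VG {g} u.
Arguments EG {g u v} e.
Arguments alpha {g u v} e.
Arguments omega {g u v} e.
Arguments alpha_inj {g u v} e.
Arguments omega_inj {g u v} e.
Arguments eflip {g u v e} x.

(** * Paths *)

(* [path_cons a0 e1 (path_cons a1 e2 .. (path_nil ak))] is the path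
   (a0, e1, a1, .., ek, ak). *)
Inductive gpath (A : gog) : A -> A -> Type :=
| path_nil (u : A) (a : VG u) : gpath u u
| path_cons (u v w : A) (a : VG u) (e : edge u v) (p : gpath v w) : gpath u w.
Arguments path_nil {A u} a.
Arguments path_cons {A u v w} a e p.

Section Paths.
Variable A : gog.
Implicit Types u v w : A.

Fixpoint plength u v (p : gpath u v) : nat :=
  match p with path_nil _ _ => 0 | path_cons _ _ _ _ _ q => (plength q).+1 end.

Definition first_elt u v (p : gpath u v) : VG u :=
  match p with path_nil _ a => a | path_cons _ _ _ a _ _ => a end.

Fixpoint last_elt u v (p : gpath u v) : VG v :=
  match p with path_nil _ a => a | path_cons _ _ _ _ _ q => last_elt q end.

Definition first_edge u v (p : gpath u v) : option (outE u) :=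
  match p with
  | path_nil _ _ => None
  | path_cons _ _ _ _ e _ => Some (out e)
  end.

(* The last edge of the path consisting of an edge ending at v, then p. *)
Fixpoint last_edge_from v w (p : gpath v w) : inE v -> inE w :=
  match p with
  | path_nil _ _ => fun e => e
  | path_cons _ _ _ _ e q => fun _ => last_edge_from q (inc e)
  end.

Definition last_edge u v (p : gpath u v) : option (inE v) :=
  match p with
  | path_nil _ _ => None
  | path_cons _ _ _ _ e q => Some (last_edge_from q (inc e))
  end.

Definition pmull u v (a : VG u) (p : gpath u v) : gpath u v :=
  match p in gpath u v return VG u -> gpath u v with
  | path_nil _ b => fun a => path_nil (a * b)
  | path_cons _ _ _ b e q => fun a => path_cons (a * b) e q
  end a.

Fixpoint pcat u v w (p : gpath u v) : gpath v w -> gpath u w :=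
  match p with
  | path_nil _ a => fun q => pmull a q
  | path_cons _ _ _ a e p' => fun q => path_cons a e (pcat p' q)
  end.

Fixpoint pinv u v (p : gpath u v) : gpath v u :=
  match p with
  | path_nil _ a => path_nil a^-1
  | path_cons _ _ _ a e q =>
      pcat (pinv q) (path_cons 1 (einv e) (path_nil a^-1))
  end.

Inductive pcong : forall u v, gpath u v -> gpath u v -> Prop :=
| pcong_edge u v (e : edge u v) (x : EG e) :
    pcong (path_cons 1 e (path_cons (omega e x) (einv e) (path_nil 1)))
          (path_nil (alpha e x))
| pcong_refl u v (p : gpath u v) : pcong p p
| pcong_sym u v (p q : gpath u v) : pcong p q -> pcong q p
| pcong_trans u v (p q r : gpath u v) : pcong p q -> pcong q r -> pcong p r
| pcong_cat u v w (p p' : gpath u v) (q q' : gpath v w) :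
    pcong p p' -> pcong q q' -> pcong (pcat p q) (pcat p' q').

Fixpoint reduced u v (p : gpath u v) : Prop :=
  match p with
  | path_nil _ _ => True
  | path_cons _ _ _ _ e q =>
      (first_edge q = Some (out (einv e)) -> ~ range (omega e) (first_elt q))
      /\ reduced q
  end.

Definition cyclically_reduced u (p : gpath u u) : Prop :=
  reduced p /\
  forall v (e : edge u v),
    first_edge p = Some (out e) -> last_edge p = Some (inc (einv e)) ->
    ~ range (alpha e) (last_elt p * first_elt p).

Fixpoint vertex_on u v (x : A) (p : gpath u v) : Prop :=
  match p with
  | path_nil y _ => y = x
  | path_cons y _ _ _ _ q => y = x \/ vertex_on x q
  end.

Fixpoint edge_on u v (f : allE A) (p : gpath u v) : Prop :=
  match p with
  | path_nil _ _ => False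
  | path_cons _ _ _ _ e q => tot e = f \/ edge_on f q
  end.

Definition core_vertex (x : A) : Prop :=
  exists u (p : gpath u u),
    [/\ 0 < plength p, cyclically_reduced p & vertex_on x p].

Definition core_edge (f : allE A) : Prop :=
  exists u (p : gpath u u),
    [/\ 0 < plength p, cyclically_reduced p & edge_on f p].

(* core(A) is the restriction of A to [core_vertex] and [core_edge], so that
   A = core(A) means that these predicates hold everywhere. *)
Definition is_core : Prop :=
  (forall x : A, core_vertex x) /\ (forall f : allE A, core_edge f).

Definition k_acylindrical (k : nat) : Prop :=
  forall u v (p : gpath u v), plength p = k -> reduced p ->
  forall a : VG v, a <> 1 ->
  forall b : VG u, ~ pcong (pcat (pcat p (path_nil a)) (pinv p)) (path_nil b).

Definition acylindrical : Prop := exists k : nat, k_acylindrical k.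

End Paths.

(** * Morphisms *)

(* The group data over a graph morphism m.  Only the alpha-twisting elements
   are stored: the omega-twisting element of f is [twist (einv f)]. *)
Record mor_data (B A : gog) (m : graph_mor B A) := MorData {
  vhom : forall v : B, ghom (VG v) (VG (m v));
  ehom : forall (u v : B) (f : edge u v), ghom (EG f) (EG (emap m f));
  vhom_inj : forall v : B, injective (vhom v);
  ehom_inj : forall (u v : B) (f : edge u v), injective (ehom f);
  twist : forall u v : B, edge u v -> VG (m u);
  alpha_ehom : forall (u v : B) (f : edge u v) (x : EG f),
    alpha (emap m f) (ehom f x) = vhom u (alpha f x) ^ twist f;
  omega_ehom : forall (u v : B) (f : edge u v) (x : EG f),
    omega (emap m f) (ehom f x) = vhom v (omega f x) ^ twist (einv f) }.
Arguments vhom {B A m} _ v.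
Arguments ehom {B A m} _ {u v} f.
Arguments twist {B A m} _ {u v} _.

Record mor (B A : gog) := Mor { mgr :> graph_mor B A; mdata :> mor_data mgr }.

Section Immersions.
Variables (B A : gog) (mu : mor B A).

(* The double coset mu_v(B_v) f_alpha alpha_e(A_e), where e = mu(f). *)
Definition dcoset (v w : B) (f : edge v w) : set (VG (mu v)) :=
  [set x | exists (b : VG v) (a : EG (emap mu f)),
             x = vhom mu v b * twist mu f * alpha (emap mu f) a].

Definition is_immersion : Prop :=
  (forall (v w w' : B) (f : edge v w) (f' : edge v w'),
     out (emap mu f) = out (emap mu f') ->
     (out f = out f' <-> dcoset f = dcoset f')) /\
  (forall (v w : B) (f : edge v w),
     alpha (emap mu f) @` range (ehom mu f) =
     ((fun x => x ^ twist mu f) @` range (vhom mu v))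
       `&` range (alpha (emap mu f))).

End Immersions.
Arguments dcoset {B A} mu {v w} f.

(* The first condition on b reads b_(f^-1) = b_f, through the identification
   [eflip] and mu(f^-1) = mu(f)^-1. *)
Definition data_approx (B A : gog) (m : graph_mor B A) (d1 d2 : mor_data m)
    : Prop :=
  exists (a : forall v : B, VG (m v))
         (b : forall (u v : B) (f : edge u v), EG (emap m f)),
  [/\ forall (u v : B) (f : edge u v),
        existT (fun e : edge (m v) (m u) => EG e)
               (emap m (einv f)) (b v u (einv f))
        = existT (fun e : edge (m v) (m u) => EG e)
                 (einv (emap m f)) (eflip (b u v f)),
      forall (v : B) (x : VG v), vhom d2 v x = vhom d1 v x ^ a v &
      forall (u v : B) (f : edge u v),
        a u = twist d1 f * alpha (emap m f) (b u v f) * (twist d2 f)^-1].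

Definition approx (B A : gog) (mu1 mu2 : mor B A) : Prop :=
  exists h : mgr mu1 = mgr mu2,
    data_approx (ecast m (mor_data m) h (mdata mu1)) (mdata mu2).

(** * Composition and identities *)

Section GraphComp.
Variables (C B A : graph) (nu : graph_mor B A) (mu : graph_mor C B).

Lemma gcomp_emapV (u v : C) (f : edge u v) :
  emap nu (emap mu (einv f)) = einv (emap nu (emap mu f)).
Proof. by rewrite !emapV. Qed.

Definition gcomp : graph_mor C A :=
  @GraphMor C A (fun v => nu (mu v)) (fun u v f => emap nu (emap mu f))
    gcomp_emapV.
End GraphComp.

Definition gid (A : graph) : graph_mor A A :=
  @GraphMor A A id (fun u v e => e) (fun u v e => erefl).

Section Comp.
Variables (C B A : gog) (nu : mor B A) (mu : mor C B).

Let tw (u v : C) (f : edge u v) : VG (nu (mu u)) :=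
  vhom nu (mu u) (twist mu f) * twist nu (emap mu f).

Lemma comp_vhom_inj (v : C) : injective (vhom nu (mu v) \o vhom mu v).
Proof. exact: inj_comp (@vhom_inj _ _ _ nu _) (@vhom_inj _ _ _ mu _). Qed.

Lemma comp_ehom_inj (u v : C) (f : edge u v) :
  injective (ehom nu (emap mu f) \o ehom mu f).
Proof.
exact: inj_comp (@ehom_inj _ _ _ nu _ _ _) (@ehom_inj _ _ _ mu _ _ _).
Qed.

Lemma comp_alpha (u v : C) (f : edge u v) (x : EG f) :
  alpha (emap (gcomp nu mu) f) ((ehom nu (emap mu f) \o ehom mu f) x) =
  (vhom nu (mu u) \o vhom mu u) (alpha f x) ^ tw f.
Proof. by rewrite /= !alpha_ehom gmulfJ conjgM. Qed.

Lemma comp_omega (u v : C) (f : edge u v) (x : EG f) :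
  omega (emap (gcomp nu mu) f) ((ehom nu (emap mu f) \o ehom mu f) x) =
  (vhom nu (mu v) \o vhom mu v) (omega f x) ^ tw (einv f).
Proof. by rewrite /= !omega_ehom gmulfJ conjgM /tw emapV. Qed.

Definition mcomp : mor C A :=
  Mor (@MorData C A (gcomp nu mu)
         (fun v => vhom nu (mu v) \o vhom mu v)
         (fun u v f => ehom nu (emap mu f) \o ehom mu f)
         comp_vhom_inj comp_ehom_inj tw comp_alpha comp_omega).
End Comp.

Section Id.
Variable A : gog.

Lemma id_alpha (u v : A) (e : edge u v) (x : EG e) :
  alpha e x = alpha e x ^ 1.
Proof. by rewrite conjg1. Qed.

Lemma id_omega (u v : A) (e : edge u v) (x : EG e) :
  omega e x = omega e x ^ 1.
Proof. by rewrite conjg1. Qed.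

Definition mid : mor A A :=
  Mor (@MorData A A (gid A) (fun v => idfun) (fun u v e => idfun)
         (fun v => @inj_id _) (fun u v e => @inj_id _) (fun u v e => 1)
         id_alpha id_omega).
End Id.

(** * The category K *)

Lemma eflip_eqP (A : gog) (u v : A) (e : edge u v) (e' : edge v u)
    (x : EG e) (x' : EG e') : e' = einv e ->
  existT (fun e : edge v u => EG e) e' x'
    = existT (fun e : edge v u => EG e) (einv e) (eflip x)
  <-> alpha e' x' = omega e x.
Proof.
move=> ee'; subst e'; rewrite -alpha_flip; split=> [E|/alpha_inj -> //].
exact: (f_equal (fun s => alpha (projT1 s) (projT2 s)) E).
Qed.

Section ApproxTheory.

Lemma data_approx_refl (B A : gog) (m : graph_mor B A) (d : mor_data m) :
  data_approx d d.
Proof.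
exists (fun=> 1), (fun _ _ _ => 1); split=> [u v f|v x|u v f].
- by apply/eflip_eqP; rewrite ?emapV // !gmulf1.
- by rewrite conjg1.
- by rewrite gmulf1 mulg1 mulgV.
Qed.

Lemma approx_refl (B A : gog) (mu : mor B A) : approx mu mu.
Proof. exists erefl; exact: data_approx_refl. Qed.

Lemma approx_sym (B A : gog) (mu1 mu2 : mor B A) :
  approx mu1 mu2 -> approx mu2 mu1.
Proof.
case: mu1 mu2 => [m d1] [m' d2] [/= h]; subst m' => /= -[a [b [bV aE abE]]].
exists erefl => /=.
exists (fun v => (a v)^-1), (fun u v f => (b u v f)^-1).
split=> [u v f|v x|u v f].
- apply/eflip_eqP; rewrite ?emapV // !gmulfV; congr (_ ^-1).
  by apply/eflip_eqP; rewrite ?emapV.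
- by rewrite aE -conjgM mulgV conjg1.
- by rewrite (abE u v f) !invgM invgK gmulfV mulgA.
Qed.

Lemma approx_trans (B A : gog) (mu1 mu2 mu3 : mor B A) :
  approx mu1 mu2 -> approx mu2 mu3 -> approx mu1 mu3.
Proof.
case: mu1 mu2 mu3 => [m d1] [m' d2] [m'' d3] [/= h]; subst m' => /=.
move=> [a [b [bV aE abE]]] [/= h]; subst m'' => /= -[c [d [dV cE cdE]]].
exists erefl => /=.
exists (fun v => a v * c v), (fun u v f => b u v f * d u v f).
split=> [u v f|v x|u v f].
- apply/eflip_eqP; rewrite ?emapV // !gmulfM; congr (_ * _).
  + by apply/eflip_eqP; rewrite ?emapV.
  + by apply/eflip_eqP; rewrite ?emapV.
- by rewrite cE aE conjgM.
- by rewrite (abE u v f) (cdE u v f) gmulfM !mulgA mulgVK.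
Qed.

Lemma approx_comp (C B A : gog) (nu nu' : mor B A) (mu mu' : mor C B) :
  approx nu nu' -> approx mu mu' -> approx (mcomp nu mu) (mcomp nu' mu').
Proof.
case: nu nu' => [n e1] [n' e2] [/= h]; subst n' => /= -[c [d [dV cE cdE]]].
case: mu mu' => [m d1] [m' d2] [/= h]; subst m' => /= -[a [b [bV aE abE]]].
exists erefl => /=.
exists (fun v => vhom e1 (m v) (a v) * c (m v)).
exists (fun u v f => ehom e1 (emap m f) (b u v f) * d _ _ (emap m f)).
split=> [u v f|v x|u v f] /=.
- apply/(eflip_eqP (e := emap n (emap m f))); rewrite ?emapV //.
  have Hb : alpha (emap m (einv f)) (b v u (einv f)) = omega (emap m f) (b u v f).
    by apply/eflip_eqP; rewrite ?emapV.
  have Hd : alpha (emap n (einv (emap m f))) (d _ _ (einv (emap m f)))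
          = omega (emap n (emap m f)) (d _ _ (emap m f)).
    by apply/eflip_eqP; rewrite ?emapV.
  rewrite !gmulfM alpha_ehom omega_ehom Hb -Hd; congr (_ ^ _ * _).
    by rewrite emapV.
  by rewrite emapV.
- by rewrite cE aE gmulfJ conjgM.
- have -> : vhom e2 (m u) (twist d2 f) = vhom e1 (m u) (twist d2 f) ^ c (m u).
    exact: cE.
  rewrite (abE u v f) !gmulfM gmulfV alpha_ehom (cdE _ _ (emap m f)).
  set x := vhom e1 _ (twist d1 f); set y := vhom e1 _ (twist d2 f).
  set z := vhom e1 _ (alpha _ _); set t := twist e1 _; set t' := twist e2 _.
  set w := alpha _ _.
  by rewrite !conjgE !invgM !invgK !mulgA; do !rewrite ?mulgVK ?mulgK.
Qed.

(* Two morphisms with the same components, whose graph morphisms may differ in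
   the proof that they commute with inversion. *)
Lemma approx_same (B A : gog) (V : B -> A)
    (E : forall u v : B, edge u v -> edge (V u) (V v)) p p'
    (d : mor_data (@GraphMor B A V E p)) (d' : mor_data (@GraphMor B A V E p')) :
  (forall v x, vhom d v x = vhom d' v x) ->
  (forall u v (f : edge u v), twist d f = twist d' f) ->
  approx (Mor d) (Mor d').
Proof.
move=> dE tE; have pp' : p = p' by exact: Prop_irrelevance.
subst p'; exists erefl => /=.
exists (fun=> 1), (fun _ _ _ => 1); split=> [u v f|v x|u v f].
- by apply/eflip_eqP; rewrite ?p // !gmulf1.
- by rewrite conjg1 dE.
- by rewrite gmulf1 mulg1 tE mulgV.
Qed.

Lemma approx_compA (D C B A : gog) (l : mor B A) (nu : mor C B)
    (mu : mor D C) :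
  approx (mcomp l (mcomp nu mu)) (mcomp (mcomp l nu) mu).
Proof. by apply: approx_same => //= u v f; rewrite gmulfM mulgA. Qed.

Lemma approx_comp1 (B A : gog) (mu : mor B A) : approx (mcomp mu (mid B)) mu.
Proof.
case: mu => [[V E p] d]; apply: approx_same => //= u v f.
by rewrite gmulf1 mul1g.
Qed.

Lemma approx_1comp (B A : gog) (mu : mor B A) : approx (mcomp (mid A) mu) mu.
Proof.
case: mu => [[V E p] d]; apply: approx_same => //= u v f.
by rewrite mulg1.
Qed.

End ApproxTheory.

Section ImmersionTheory.

Lemma dcoset_out (B A : gog) (mu : mor B A) (v w w' : B) (f : edge v w)
    (f' : edge v w') : out f = out f' -> dcoset mu f = dcoset mu f'.
Proof. exact: (f_equal (fun s : outE v => dcoset mu (projT2 s))). Qed.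

Lemma dcoset_eq (B A : gog) (mu : mor B A) (v w w' : B) (f : edge v w)
    (f' : edge v w') : out (emap mu f) = out (emap mu f') ->
  dcoset mu f (twist mu f') -> dcoset mu f = dcoset mu f'.
Proof.
pose DC (t : VG (mu v)) (s : outE (mu v)) := [set x | exists b a,
  x = vhom mu v b * t * alpha (projT2 s) a].
rewrite -[dcoset mu f]/(DC _ (out _)) -[dcoset mu f']/(DC _ (out _)) => <-.
move=> [b [a E]]; rewrite /DC E; apply/seteqP; split=> x [b' [a' ->]].
- exists (b' * b^-1), (a^-1 * a').
  by rewrite !gmulfM !gmulfV !mulgA mulgVK mulgK.
- by exists (b' * b), (a * a'); rewrite !gmulfM !mulgA.
Qed.

Lemma twist_dcoset (B A : gog) (mu : mor B A) (v w : B) (f : edge v w) :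
  dcoset mu f (twist mu f).
Proof. by exists 1, 1; rewrite !gmulf1 mul1g mulg1. Qed.

Lemma mid_immersion (A : gog) : is_immersion (mid A).
Proof.
split=> [v w w' f f' E|v w f].
  by split=> // _; apply: dcoset_out.
apply/seteqP; split=> x /=.
- move=> [_ [y _ <-] <-]; split; last by exists y.
  by exists (alpha f y); rewrite ?conjg1 //; exists (alpha f y).
- by move=> [_ [y _ <-]]; exists y => //; exists y.
Qed.

Lemma mcomp_immersion (C B A : gog) (nu : mor B A) (mu : mor C B) :
  is_immersion nu -> is_immersion mu -> is_immersion (mcomp nu mu).
Proof.
move=> [nu1 nu2] [mu1 mu2]; split=> [v w w' f f' E|v w f].
- split=> [|D]; first exact: dcoset_out.
  have := twist_dcoset (mcomp nu mu) f'; rewrite -D => -[/= c [a]].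
  move/(congr1 (mul (vhom nu (mu v) (twist mu f'))^-1)).
  rewrite mulKg !mulgA -gmulfV -!gmulfM => tE.
  have mE : out (emap mu f) = out (emap mu f').
    apply/(nu1 _ _ _ _ _ E)/dcoset_eq => //.
    by exists ((twist mu f')^-1 * vhom mu v c * twist mu f), a.
  have tt : twist nu (emap mu f) = twist nu (emap mu f').
    exact: (f_equal (fun s : outE (mu v) => twist nu (projT2 s)) mE).
  move: tE; rewrite -tt; set b := _ * twist mu f; set t := twist nu _ => tE.
  have bE : vhom nu (mu v) b ^ t = alpha (emap nu (emap mu f)) a^-1.
    rewrite gmulfV; apply: (mulIg (alpha (emap nu (emap mu f)) a)).
    by rewrite mulVg conjgE -!mulgA [_ * (t * _)]mulgA -tE mulVg.
  have : (alpha (emap nu (emap mu f)) @` range (ehom nu (emap mu f)))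
           (alpha (emap nu (emap mu f)) a^-1).
    rewrite nu2; split; last by exists a^-1.
    by exists (vhom nu (mu v) b) => //; exists b.
  move=> [_ [y _ <-]]; rewrite -bE alpha_ehom => /conjg_inj.
  move/(@vhom_inj _ _ _ nu) => yE.
  apply/(mu1 _ _ _ _ _ mE)/dcoset_eq => //; exists c, y^-1.
  by rewrite gmulfV yE /b !invgM invgK !mulgA mulgK mulgV mul1g.
- apply/seteqP; split=> x.
  + move=> [_ [y _ <-] <-]; split; last by eexists.
    by exists (vhom (mcomp nu mu) v (alpha f y)); [exists (alpha f y)|
       rewrite -alpha_ehom].
  + move=> [[_ [c _ <-] <-] [a _ aE]].
    have cE : vhom (mcomp nu mu) v c ^ twist (mcomp nu mu) f
            = vhom nu (mu v) (vhom mu v c ^ twist mu f) ^ twist nu (emap mu f).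
      by rewrite gmulfJ -conjgM.
    have : (alpha (emap nu (emap mu f)) @` range (ehom nu (emap mu f)))
             (vhom nu (mu v) (vhom mu v c ^ twist mu f) ^ twist nu (emap mu f)).
      rewrite nu2; split; last by exists a; rewrite // -cE.
      by eexists => //; eexists.
    move=> [_ [y _ <-]]; rewrite alpha_ehom => /conjg_inj.
    move/(@vhom_inj _ _ _ nu) => yE.
    have : (alpha (emap mu f) @` range (ehom mu f)) (alpha (emap mu f) y).
      rewrite mu2; split; last by exists y.
      by exists (vhom mu v c); [exists c | rewrite yE].
    move=> [_ [z _ <-]] /alpha_inj zE.
    exists (ehom (mcomp nu mu) f z); first by exists z.
    by rewrite cE -yE -alpha_ehom -zE.
Qed.

End ImmersionTheory.

Record core_gog := CoreGog { cgog :> gog; cgogP : is_core cgog }.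

Record immersion (B A : gog) :=
  Immersion { imm :> mor B A; immP : is_immersion imm }.

Definition icomp (C B A : gog) (nu : immersion B A) (mu : immersion C B) :=
  Immersion (mcomp_immersion (immP nu) (immP mu)).

Definition catK : category :=
  @Category core_gog (fun B A => immersion B A)
    (fun B A mu nu => approx mu nu)
    (fun A => Immersion (mid_immersion A))
    (fun C B A nu mu => icomp nu mu)
    (fun B A mu => approx_refl mu)
    (fun B A mu nu => @approx_sym _ _ mu nu)
    (fun B A l mu nu => @approx_trans _ _ l mu nu)
    (fun C B A nu nu' mu mu' => @approx_comp _ _ _ nu nu' mu mu')
    (fun D C B A l nu mu => approx_compA l nu mu)
    (fun B A mu => approx_comp1 mu)
    (fun B A mu => approx_1comp mu).

(* Main.v *)
From HB Require Import structures.
From mathcomp Require Import all_boot.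
From mathcomp Require Import boolp classical_sets.
Require Import Defs.

Set Implicit Arguments.
Unset Strict Implicit.
Unset Printing Implicit Defensive.

Local Open Scope group_scope.

(** Let muB : B -> A and muC : C -> A be immersions.  A vertex of the pullback
    should be a vertex v of B and a vertex w of C with the same image u in A,
    together with a double coset B_v a C_w of A_u; an edge should be an edge f
    of B and an edge g of C with the same image e, together with a double coset
    B_f x C_g of A_e.  The vertex group is B_v^a cap C_w, which appears here as
    the fibre product of the pairs (b, c) with muC c = (muB b)^a; edge groups
    are similar.  The origin of the edge (f, g, x) is the double coset of
    f_alpha alpha_e(x) g_alpha^-1.

    Double cosets are awkward because the projections to B and C need twisting
    elements that depend on representatives.  So the construction begins with a
    larger graph of groups [rawgog] that has a vertex for every a, not only for
    every double coset, and an edge for every x together with every choice of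
    elements beta, kappa at both ends with
      a = beta f_alpha alpha_e(x) g_alpha^-1 kappa^-1.
    The elements beta and kappa are the twisting elements of the projections
    [rawB], [rawC].  The equation is the definition of equivalence of
    muB rawB and muC rawC, so a pair of morphisms X -> B, X -> C with
    equivalent composites in A is literally a morphism X -> [rawgog]:
    this is [raw_universal].

    Then one vertex is chosen in each double coset, and one edge in each class
    of edges between chosen vertices, compatibly with inversion
    ([canonical_vertices], [canonical_edges]).  On the subgraph [canQ] of the
    choices the projections become immersions ([canB_immersion],
    [canC_immersion]): if two edges with the same origin have the same double
    coset in B, the equation above transfers the relation to C, where muC,
    being an immersion, identifies the C-components, and their elements x are
    then in the same double coset.  The raw graph retracts onto the subgraph by
    a morphism that commutes with the projections up to equivalence
    ([retraction]), whence existence of the factorization through [canQ].  As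
    its composite with the projection to B is an immersion, the factorizing
    morphism is an immersion ([immersion_cancel]).

    Immersions map reduced paths to reduced paths, hence core graphs of groups
    into the core, and the pullback is the core of [canQ] ([coreX]).

    Acylindricity gives uniqueness.  Two factorizations s, s' of the same pair
    give a closed chain of equivalences from muB rawB s to muB rawB s', then to
    muC rawC s', to muC rawC s and back.  It yields an element z_x for every
    vertex x of the source such that q z_y q^-1 = z_x for the image q of every
    path from x to y.  The source is core, so there is a reduced path of any
    length from x; its image is reduced, and k-acylindricity forces z = 1
    ([over_rigid]).  This says that the elements a of s and s' are in the
    same double coset (so that s and s' agree on the graph), and that the
    equivalences over B and over C form a pair in the fibre product, that is,
    an equivalence of s and s' ([canonical_unique]). *)

(** * Transport along equalities, and equivalence of morphisms *)

Ltac group_cancel := do !rewrite ?mulgVK ?mulgK ?mulVg ?mulgV ?mul1g.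

Lemma existT_irr (T : Type) (P : T -> Type) (x : T) (y y' : P x) :
  existT P x y = existT P x y' -> y = y'.
Proof.
move=> E; have := projT2_eq E.
by rewrite (Prop_irrelevance (projT1_eq E) erefl).
Qed.

Lemma out_inj (G : graph) (u v : G) (e e' : edge u v) :
  out e = out e' -> e = e'.
Proof. exact: existT_irr. Qed.

Lemma inc_inj (G : graph) (u v : G) (e e' : edge u v) :
  inc e = inc e' -> e = e'.
Proof. exact: existT_irr. Qed.

Lemma tot_out (G : graph) (u v v' : G) (e : edge u v) (e' : edge u v') :
  tot e = tot e' -> out e = out e'.
Proof. exact: existT_irr. Qed.

Lemma tot_inj (G : graph) (u v : G) (e e' : edge u v) :
  tot e = tot e' -> e = e'.
Proof. by move/tot_out/out_inj. Qed.

Definition flipE (G : graph) (e : allE G) : allE G :=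
  tot (einv (projT2 (projT2 e))).

Lemma tot_einv (G : graph) (u v u' v' : G) (e : edge u v) (e' : edge u' v') :
  tot e = tot e' -> tot (einv e) = tot (einv e').
Proof. exact: (f_equal (@flipE G)). Qed.

(** The index u of a vertex group is transported by a homomorphism rather than
    by a rewriting, so that the lemmas on homomorphisms apply to transports; the
    same holds for [ec] and edge groups.  The latter compares edges with
    arbitrary ends. *)
Definition vc (A : gog) (u u' : A) (h : u = u') : ghom (VG u) (VG u') :=
  ecast x (ghom (VG u) (VG x)) h idfun.

Definition ec (A : gog) (u v u' v' : A) (e : edge u v) (e' : edge u' v')
    (h : tot e = tot e') : ghom (EG e) (EG e') :=
  ecast x (ghom (EG e) (EG (projT2 (projT2 x)))) h idfun.

Section Transport.
Variable A : gog.
Implicit Types u v : A.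

Lemma vc_id u (h : u = u) x : vc h x = x.
Proof. by rewrite (Prop_irrelevance h erefl). Qed.

Lemma vc_trans u v w (h : u = v) (k : v = w) (hk : u = w) x :
  vc k (vc h x) = vc hk x.
Proof. by subst v w; rewrite !vc_id. Qed.

Lemma vc_inj u v (h : u = v) : injective (vc h).
Proof. by subst v. Qed.

Lemma ec_id u v (e : edge u v) (h : tot e = tot e) x : ec h x = x.
Proof. by rewrite (Prop_irrelevance h erefl). Qed.

(** Path induction for edges with free ends; it reduces statements on [ec] to
    the case of identical edges. *)
Lemma tot_ind u v (e : edge u v)
    (P : forall u' v' (e' : edge u' v'), tot e = tot e' -> Type) :
  P u v e erefl -> forall u' v' (e' : edge u' v') h, P u' v' e' h.
Proof.
move=> Pe u' v' e' h.
have hu : u = u' := congr1 (@projT1 _ _) h; subst u'.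
have hv : v = v' := congr1 (@projT1 _ _) (tot_out h); subst v'.
have he := tot_inj h; subst e'.
by rewrite (Prop_irrelevance h erefl).
Qed.

Lemma alpha_ec u v u' v' (e : edge u v) (e' : edge u' v')
    (h : tot e = tot e') (hu : u = u') x : alpha e' (ec h x) = vc hu (alpha e x).
Proof.
move: u' v' e' h hu; apply: tot_ind => hu.
by rewrite vc_id.
Qed.

Lemma omega_ec u v u' v' (e : edge u v) (e' : edge u' v')
    (h : tot e = tot e') (hv : v = v') x : omega e' (ec h x) = vc hv (omega e x).
Proof.
move: u' v' e' h hv; apply: tot_ind => hv.
by rewrite vc_id.
Qed.

Lemma ecK u v u' v' (e : edge u v) (e' : edge u' v') (h : tot e = tot e')
    (h' : tot e' = tot e) : cancel (ec h) (ec h').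
Proof. by move: u' v' e' h h'; apply: tot_ind => h' x; rewrite ec_id. Qed.

Lemma ec_inj u v u' v' (e : edge u v) (e' : edge u' v') (h : tot e = tot e') :
  injective (ec h).
Proof. by move: u' v' e' h; apply: tot_ind. Qed.

End Transport.

Lemma graph_mor_ext (B A : graph) (m m' : graph_mor B A) :
  (forall v, m v = m' v) ->
  (forall u v (f : edge u v), tot (emap m f) = tot (emap m' f)) -> m = m'.
Proof.
case: m m' => [V E p] [V' E' p'] /= /funext hV; subst V' => hE.
suff ? : E = E' by subst E'; congr GraphMor; apply: Prop_irrelevance.
apply: functional_extensionality_dep => u.
apply: functional_extensionality_dep => v.
by apply: functional_extensionality_dep => f; apply: tot_inj.
Qed.

Section Over.
Variables B A : gog.

(** The data of an equivalence from mu1 to mu2 when both graph maps agree only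
    pointwise with a third one m, in which case the elements are compared after
    transport to the groups of m.  The condition that a_f be invariant under
    inversion of f is replaced by the equation at the terminus, which is
    equivalent to it; this avoids comparing the edge groups of f and f^-1. *)
Definition over (mu1 mu2 : mor B A) (m : graph_mor B A)
    (V1 : forall x, mu1 x = m x) (V2 : forall x, mu2 x = m x)
    (a : forall x, VG (m x))
    (b : forall x y (f : edge x y), EG (emap m f)) : Prop :=
  [/\ forall x y, vc (V2 x) (vhom mu2 x y) = vc (V1 x) (vhom mu1 x y) ^ a x,
      forall x y (f : edge x y), a x =
        vc (V1 x) (twist mu1 f) * alpha (emap m f) (b x y f)
          * (vc (V2 x) (twist mu2 f))^-1 &
      forall x y (f : edge x y), a y =
        vc (V1 y) (twist mu1 (einv f)) * omega (emap m f) (b x y f)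
          * (vc (V2 y) (twist mu2 (einv f)))^-1].

Lemma approx_over (mu1 mu2 : mor B A) (m : graph_mor B A)
    (V1 : forall x, mu1 x = m x) (V2 : forall x, mu2 x = m x) a b :
  (forall x y (f : edge x y), tot (emap mu1 f) = tot (emap m f)) ->
  (forall x y (f : edge x y), tot (emap mu2 f) = tot (emap m f)) ->
  over V1 V2 a b -> approx mu1 mu2.
Proof.
case: mu1 mu2 V1 V2 => [m1 d1] [m2 d2] /= V1 V2 E1 E2 [H1 H2 H3].
have ? := graph_mor_ext V1 E1; have ? := graph_mor_ext V2 E2; subst m1 m2.
exists erefl => /=; exists a, b; split.
- move=> u v f; apply/eflip_eqP; first by rewrite emapV.
  have := H2 v u (einv f); rewrite (H3 u v f) /=.
  by rewrite !vc_id => /mulIg/mulgI ->.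
- by move=> v x; have := H1 v x; rewrite !vc_id.
- by move=> u v f; rewrite (H2 u v f) !vc_id.
Qed.

Lemma approx_overP (mu1 mu2 : mor B A) : approx mu1 mu2 ->
  exists (V : forall x, mu1 x = mu2 x)
         (E : forall x y (f : edge x y), tot (emap mu1 f) = tot (emap mu2 f)) a b,
    over (m := mu2) V (fun=> erefl) a b.
Proof.
case: mu1 mu2 => [m d1] [m' d2] [/= h]; subst m' => /= -[a [b [bV aE abE]]].
exists (fun=> erefl), (fun _ _ _ => erefl), a, b; split=> //= x y f.
rewrite (abE _ _ (einv f)); congr (_ * _ * _).
by apply/eflip_eqP; rewrite ?emapV.
Qed.

End Over.

Lemma approx_compl (X Y Z : gog) (nu : mor Y Z) (mu mu' : mor X Y) :
  approx mu mu' -> approx (mcomp nu mu) (mcomp nu mu').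
Proof. by apply: approx_comp; apply: approx_refl. Qed.

Lemma approx_compr (X Y Z : gog) (nu nu' : mor Y Z) (mu : mor X Y) :
  approx nu nu' -> approx (mcomp nu mu) (mcomp nu' mu).
Proof. by move=> H; apply: approx_comp => //; apply: approx_refl. Qed.

(** * Reduced paths, their images, and rigidity *)

Section PathCalculus.
Variable A : gog.
Implicit Types u v w x y : A.

Lemma pmull1 u v (p : gpath u v) : pmull 1 p = p.
Proof. by case: p => [u' c|u' v' w' c e q] /=; rewrite mul1g. Qed.

Lemma pmullM u v (a b : VG u) (p : gpath u v) :
  pmull (a * b) p = pmull a (pmull b p).
Proof. by case: p a b => [u' c|u' v' w' c e q] a b /=; rewrite mulgA. Qed.

Lemma pcat_pmull u v w (a : VG u) (p : gpath u v) (q : gpath v w) :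
  pcat (pmull a p) q = pmull a (pcat p q).
Proof. by case: p a q => [u' c|u' v' w' c e p] a q //=; rewrite pmullM. Qed.

Lemma pcatA u v w x (p : gpath u v) (q : gpath v w) (r : gpath w x) :
  pcat p (pcat q r) = pcat (pcat p q) r.
Proof.
elim: p q => [u' c|u' v' w' c e p IH] q /=; first by rewrite pcat_pmull.
by rewrite IH.
Qed.

Lemma pinv_pmull u v (a : VG u) (p : gpath u v) :
  pinv (pmull a p) = pcat (pinv p) (path_nil a^-1).
Proof.
case: p a => [u' c|u' v' w' c e p] a /=; first by rewrite invgM.
by rewrite -pcatA /= invgM.
Qed.

Lemma plength_pmull u v (a : VG u) (p : gpath u v) :
  plength (pmull a p) = plength p.
Proof. by case: p a. Qed.

Lemma plength_pcat u v w (p : gpath u v) (q : gpath v w) :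
  plength (pcat p q) = (plength p + plength q)%N.
Proof.
elim: p q => [u' c|u' v' w' c e p IH] q /=; first by rewrite plength_pmull.
by rewrite IH.
Qed.

Lemma first_edge_pmull u v (a : VG u) (p : gpath u v) :
  first_edge (pmull a p) = first_edge p.
Proof. by case: p a. Qed.

Lemma first_elt_pmull u v (a : VG u) (p : gpath u v) :
  first_elt (pmull a p) = a * first_elt p.
Proof. by case: p a. Qed.

Lemma reduced_pmull u v (a : VG u) (p : gpath u v) :
  reduced (pmull a p) <-> reduced p.
Proof. by case: p a. Qed.

(** Reducedness of a concatenation adds a condition at the junction only. *)
Lemma reduced_pcat u v w (p : gpath u v) (q : gpath v w) :
  reduced (pcat p q) <->
  [/\ reduced p, reduced q &
      forall x (e : edge x v), last_edge p = Some (inc e) ->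
        first_edge q = Some (out (einv e)) ->
        ~ range (omega e) (last_elt p * first_elt q)].
Proof.
elim: p q => [u' c|u' v' w' c e p IH] q /=.
  by rewrite reduced_pmull; split=> [|[]].
move: e q; case: p IH => [v'' b|v'' x' w'' b e' p] IH e q /=.
- rewrite first_edge_pmull first_elt_pmull reduced_pmull; split.
  + move=> [H1 H2]; split=> // x e0 /Some_inj E.
    have ? := congr1 (@projT1 _ _) E; simpl in *; subst x.
    by move/inc_inj: E => <-.
  + by move=> [_ H1 H2]; split=> // /(H2 _ e erefl).
- move: (IH q) => /= {}IH; rewrite IH; split.
  + by move=> [H1 [H2 H3 H4]].
  + by move=> [[H1 H2] H3 H4].
Qed.

(** This turns questions on cyclic reducedness into questions on reducedness. *)
Lemma cyclically_reducedE u (p : gpath u u) :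
  cyclically_reduced p <-> reduced (pcat p p).
Proof.
rewrite reduced_pcat; split.
- move=> [H1 H2]; split=> // x e lE fE.
  have := H2 _ (einv e) fE; rewrite einvK => /(_ lE) H3 [y _ yE]; apply: H3.
  by exists (eflip y); rewrite // alpha_flip.
- move=> [H1 _ H2]; split=> // x e fE lE.
  have := H2 _ (einv e) lE; rewrite einvK => /(_ fE) H3 [y _ yE]; apply: H3.
  by exists (eflip y); rewrite // omega_flip.
Qed.

(** The path continues from any vertex x of p to the end of p, then along r. *)
Lemma reduced_suffix u v w x (p : gpath u v) (r : gpath v w) :
  vertex_on x p -> reduced (pcat p r) ->
  exists q : gpath x w, plength r <= plength q /\ reduced q.
Proof.
elim: p r => [u' c|u' v' w' c e p IH] r /=.
  by move=> <- H; exists (pmull c r); rewrite plength_pmull.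
case=> [<- H|/IH H1 [_ /H1]//].
by exists (pcat (path_cons c e p) r); split=> //=; rewrite plength_pcat leqW // leq_addl.
Qed.

Lemma reduced_prefix u v (p : gpath u v) k : k <= plength p -> reduced p ->
  exists y (q : gpath u y), [/\ plength q = k, reduced q &
    first_edge q = None \/
    first_edge q = first_edge p /\ first_elt q = first_elt p].
Proof.
elim: p k => [u' c|u' v' w' c e p IH] [|k] //=.
- by exists u', (path_nil 1); split=> //; left.
- by exists u', (path_nil 1); split=> //; left.
- rewrite ltnS => /IH{}IH [H1 /IH[y [q [qk qr qE]]]].
  exists y, (path_cons c e q); split=> /=; [by rewrite qk| |by right].
  by split=> //; case: qE => [->//|[-> ->]].
Qed.

Lemma first_pcat u v w (p : gpath u v) (q : gpath v w) : 0 < plength p ->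
  first_edge (pcat p q) = first_edge p /\ first_elt (pcat p q) = first_elt p.
Proof. by case: p q. Qed.

(** A cyclically reduced circuit through x can be followed from x and repeated
    as often as wanted, and cut at length k. *)
Lemma core_long_path : is_core A -> forall (x : A) k,
  exists y (q : gpath x y), plength q = k /\ reduced q.
Proof.
move=> [cA _] x k; have [u [p [p0 pr xp]]] := cA x.
have [r [rk rr]] : exists r : gpath u u, k <= plength r /\ reduced (pcat p r).
  have {pr}pr : reduced (pcat p p) by apply/cyclically_reducedE.
  elim: k => [|k [r [rk rr]]]; first by exists p.
  exists (pcat p r); split; first by rewrite plength_pcat -add1n leq_add.
  have /reduced_pcat[H1 _ H2] := pr; apply/reduced_pcat; split=> // y e.
  by have [-> ->] := first_pcat r p0; apply: H2.
have [q [qk qr]] := reduced_suffix xp rr.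
by have [y [q' [? ? _]]] := reduced_prefix (leq_trans rk qk) qr; exists y, q'.
Qed.

End PathCalculus.

Section PathImage.
Variables (B A : gog) (mu : mor B A).

(** The twisting elements are absorbed by the neighbouring group elements, so
    that pmap is compatible with concatenation and with the congruence. *)
Fixpoint pmap (u v : B) (p : gpath u v) : gpath (mu u) (mu v) :=
  match p with
  | path_nil u a => path_nil (vhom mu u a)
  | path_cons u _ _ a e q =>
      path_cons (vhom mu u a * twist mu e) (emap mu e)
        (pmull (twist mu (einv e))^-1 (pmap q))
  end.

Lemma pmap_pmull u v (a : VG u) (p : gpath u v) :
  pmap (pmull a p) = pmull (vhom mu u a) (pmap p).
Proof. by case: p a => [u' c|u' v' w' c e p] a /=; rewrite gmulfM ?mulgA. Qed.

Lemma pmap_pcat u v w (p : gpath u v) (q : gpath v w) :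
  pmap (pcat p q) = pcat (pmap p) (pmap q).
Proof.
elim: p q => [u' c|u' v' w' c e p IH] q /=; first by rewrite pmap_pmull.
by rewrite IH pcat_pmull.
Qed.

Lemma plength_pmap u v (p : gpath u v) : plength (pmap p) = plength p.
Proof. by elim: p => //= u' v' w' c e p IH; rewrite plength_pmull IH. Qed.

Lemma vertex_on_pmull (x u v : A) (a : VG u) (p : gpath u v) :
  vertex_on x (pmull a p) <-> vertex_on x p.
Proof. by case: p a. Qed.

Lemma edge_on_pmull (f : allE A) (u v : A) (a : VG u) (p : gpath u v) :
  edge_on f (pmull a p) <-> edge_on f p.
Proof. by case: p a. Qed.

Lemma vertex_on_pmap x u v (p : gpath u v) :
  vertex_on x p -> vertex_on (mu x) (pmap p).
Proof.
elim: p => [u' c|u' v' w' c e p IH] /=; first by move->.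
by rewrite vertex_on_pmull => -[->|/IH]; [left|right].
Qed.

Lemma edge_on_pmap x y (f : edge x y) u v (p : gpath u v) :
  edge_on (tot f) p -> edge_on (tot (emap mu f)) (pmap p).
Proof.
elim: p => [u' c|u' v' w' c e p IH] //=; rewrite edge_on_pmull.
move=> [E|/IH]; [left|by right].
exact: (f_equal (fun s : allE B => tot (emap mu (projT2 (projT2 s)))) E).
Qed.

Lemma first_edge_pmap u v (p : gpath u v) s : first_edge (pmap p) = Some s ->
  exists w (f : edge u w), [/\ first_edge p = Some (out f),
    s = out (emap mu f) & first_elt (pmap p) = vhom mu u (first_elt p) * twist mu f].
Proof.
by move: s; case: p => //= u' v' w' c e p s [<-]; exists v', e.
Qed.

End PathImage.

Section ImmersionPaths.
Variables (B A : gog) (mu : mor B A).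
Hypothesis mu_imm : is_immersion mu.

(** The two conditions on an immersion, in the form in which they are used: an
    equality of double cosets is a factorization of a twisting element, and an
    element of the intersection comes from the edge group. *)
Lemma imm_fold (v w w' : B) (f : edge v w) (f' : edge v w')
    (c : VG v) (x : EG (emap mu f)) : out (emap mu f) = out (emap mu f') ->
  twist mu f' = vhom mu v c * twist mu f * alpha (emap mu f) x ->
  out f = out f'.
Proof.
move=> E tE; apply/(mu_imm.1 _ _ _ _ _ E)/dcoset_eq => //.
by exists c, x.
Qed.

Lemma imm_edge_group (v w : B) (f : edge v w) (c : VG v) (x : EG (emap mu f)) :
  vhom mu v c ^ twist mu f = alpha (emap mu f) x ->
  exists2 y, alpha f y = c & ehom mu f y = x.
Proof.
move=> cE.
have : (range (alpha (emap mu f)) `&`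
        ((fun x => x ^ twist mu f) @` range (vhom mu v)))%classic
        (alpha (emap mu f) x).
  split; first by exists x.
  by exists (vhom mu v c); [exists c|].
rewrite setIC -mu_imm.2 => -[_ [y _ <-] /alpha_inj yx]; exists y => //.
apply: (@vhom_inj _ _ _ mu); apply: (@conjg_inj _ (twist mu f)).
by rewrite /= -alpha_ehom cE yx.
Qed.

(** If the image backtracks along e and f, the equation saying that the element
    between them is in the edge group puts the twisting elements of f and of
    e^-1 in one double coset; so f = e^-1, and the other condition on immersions
    brings the element back to the edge group of e. *)
Lemma pmap_reduced u v (p : gpath u v) : reduced p -> reduced (pmap mu p).
Proof.
elim: p => [u' c|u' v' w' c e p IH] //= [H1 /IH{}IH].
rewrite reduced_pmull first_edge_pmull first_elt_pmull; split=> //.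
move=> /first_edge_pmap[x [f [fE sE ->]]] [y _ yE].
set t := twist mu (einv e) in yE.
have E : out (emap mu (einv e)) = out (emap mu f) by rewrite emapV.
pose y' : EG (emap mu (einv e)) := ec (congr1 (fun f => tot f) (esym (emapV mu e))) (eflip y).
have y'E : alpha (emap mu (einv e)) y' = omega (emap mu e) y.
  by rewrite (alpha_ec _ erefl) vc_id alpha_flip.
have := @imm_fold _ _ _ (einv e) f (first_elt p)^-1 y' E.
rewrite y'E yE -/t gmulfV !mulgA mulgK mulVg mul1g => /(_ erefl) ef.
have tE : twist mu f = t.
  exact: (esym (f_equal (fun s : outE v' => twist mu (projT2 s)) ef)).
have [|z zE _] := @imm_edge_group _ _ (einv e) (first_elt p) y'.
  by rewrite y'E yE tE conjgE !mulgA.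
apply: H1; first by rewrite fE ef.
have [z' z'E] : exists z', alpha (einv e) z = omega e z'.
  pose z' := ec (congr1 (fun f => tot f) (einvK e)) (eflip z); exists z'.
  by rewrite (omega_ec _ erefl) vc_id omega_flip.
by exists z'; rewrite // -z'E zE.
Qed.

Lemma pmap_cyclically_reduced u (p : gpath u u) :
  cyclically_reduced p -> cyclically_reduced (pmap mu p).
Proof.
by move=> /cyclically_reducedE/pmap_reduced; rewrite pmap_pcat;
  move/cyclically_reducedE.
Qed.

Lemma core_vertex_map (x : B) : core_vertex x -> core_vertex (mu x).
Proof.
move=> [u [p [p0 pr xp]]]; exists (mu u), (pmap mu p).
by split; [rewrite plength_pmap|exact: pmap_cyclically_reduced|
  exact: vertex_on_pmap].
Qed.

Lemma core_edge_map (x y : B) (f : edge x y) :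
  core_edge (tot f) -> core_edge (tot (emap mu f)).
Proof.
move=> [u [p [p0 pr xp]]]; exists (mu u), (pmap mu p).
by split; [rewrite plength_pmap|exact: pmap_cyclically_reduced|
  exact: edge_on_pmap].
Qed.

End ImmersionPaths.

Lemma conjV_eq1 (G : groupType) (s x : G) : 1 = s * x * s^-1 -> x = 1.
Proof.
by move/(congr1 (fun y => y ^ s)); rewrite conj1g conjgE !mulgA mulgVK mulVg mul1g.
Qed.

Section Rigidity.
Variables (B A : gog).

(** A self-equivalence z of mu is carried along the image of each path. *)
Lemma pcong_conj (mu : mor B A) z zf :
  over (m := mu) (mu1 := mu) (mu2 := mu) (fun=> erefl) (fun=> erefl) z zf ->
  forall x y (p : gpath x y),
  pcong (pcat (pcat (pmap mu p) (path_nil (z y))) (pinv (pmap mu p)))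
        (path_nil (z x)).
Proof.
move=> [/= zC zT zT'] x y p.
have zM u a : vhom mu u a * z u * (vhom mu u a)^-1 = z u.
  by rewrite (conjgC (vhom mu u a)) -zC mulgK.
elim: p => [u a|u v w a e p IH] /=; first by rewrite zM; apply: pcong_refl.
set t := twist mu e; set s := twist mu (einv e).
set b := vhom mu u a * t; set e' := emap mu e.
rewrite pinv_pmull !pcat_pmull -!pcatA /=.
set Q := pcat _ _; set r := path_cons _ (einv e') _ in Q *.
have QE : Q = pcat (pcat (pcat (pmap mu p) (path_nil (z w)))
                         (pinv (pmap mu p))) r by rewrite -!pcatA.
(* The induction hypothesis contracts everything between e' and its inverse
   to s^-1 * z v * s, which lies in the edge group. *)
have {}IH : pcong (path_cons b e' (pmull s^-1 Q))
                  (path_cons b e' (pmull s^-1 (pcat (path_nil (z v)) r))).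
  rewrite -[path_cons b _ (pmull _ Q)]/(pcat (path_cons b e' (path_nil s^-1)) Q).
  rewrite -[path_cons b _ (pmull _ (pcat _ _))]
    /(pcat (path_cons b e' (path_nil s^-1)) (pcat _ _)).
  rewrite QE; apply: pcong_cat; first exact: pcong_refl.
  by apply: pcong_cat => //; exact: pcong_refl.
apply: pcong_trans IH _; rewrite /r /=.
have -> : s^-1 * (z v * (s^-1^-1 * 1)) = omega e' (zf _ _ e).
  by rewrite (zT' _ _ e) -/s invgK mulg1 !mulgA mulgVK mulVg mul1g.
have := pcong_cat (pcong_refl (path_nil b))
  (pcong_cat (pcong_edge (zf _ _ e)) (pcong_refl (path_nil b^-1))).
have -> : z u = b * (alpha e' (zf _ _ e) * b^-1).
  by rewrite -{1}(zM _ a) (zT _ _ e) -/t /b invgM !mulgA.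
by rewrite /= ?mulg1 ?mul1g.
Qed.

(** The element z at the end of a reduced path of length k is trivial by
    acylindricity, and z = 1 propagates back along the path. *)
Lemma over_rigid (k : nat) (mu : mor B A) (m : graph_mor B A)
    (V : forall x, mu x = m x) z zf :
  is_core B -> k_acylindrical A k -> is_immersion mu ->
  (forall x y (f : edge x y), tot (emap mu f) = tot (emap m f)) ->
  over V V z zf ->
  (forall x, z x = 1) /\ (forall x y (f : edge x y), zf x y f = 1).
Proof.
move=> cB Ak mu_imm E H; have ? := graph_mor_ext V E; subst m.
have {}H : over (m := mu) (mu1 := mu) (mu2 := mu) (fun=> erefl) (fun=> erefl) z zf.
  case: H => H1 H2 H3; split=> [x y|x y f|x y f] /=.
  - by have := H1 x y; rewrite !vc_id.
  - by rewrite (H2 _ _ f) !vc_id.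
  - by rewrite (H3 _ _ f) !vc_id.
have [_ zT zT'] := H.
have z1 x : z x = 1.
  have [y [q [qk qr]]] := core_long_path cB x k.
  have zy : z y = 1.
    apply: contrapT => zy.
    apply: (Ak _ _ (pmap mu q) _ _ _ zy (z x)); first by rewrite plength_pmap.
      exact: pmap_reduced.
    exact: pcong_conj H _ _ q.
  elim: q zy {qk qr} => [//|u v w a e q IH] /IH zv.
  have zf1 : zf _ _ e = 1.
    by apply: (omega_inj (emap mu e)); rewrite gmulf1;
      apply: (conjV_eq1 (s := twist mu (einv e))); rewrite -(zT' _ _ e).
  by rewrite (zT _ _ e) zf1 gmulf1 mulg1 mulgV.
split=> // x y f; apply: (alpha_inj (emap mu f)); rewrite gmulf1.
by apply: (conjV_eq1 (s := twist mu f)); rewrite -(zT _ _ f) z1.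
Qed.

End Rigidity.

(** * Immersions, subgraphs of groups, and the core *)

Lemma sval_inj (T : Type) (P : T -> Prop) : injective (@sval T P).
Proof. by move=> [x hx] [y hy] /= ?; apply: eq_exist. Qed.

Section ImmersionCriterion.

(** Converse of [imm_fold] and [imm_edge_group]. *)
Lemma immersionI (B A : gog) (mu : mor B A) :
  (forall (v w w' : B) (f : edge v w) (f' : edge v w') c x,
     out (emap mu f) = out (emap mu f') ->
     twist mu f' = vhom mu v c * twist mu f * alpha (emap mu f) x ->
     out f = out f') ->
  (forall (v w : B) (f : edge v w) c x,
     vhom mu v c ^ twist mu f = alpha (emap mu f) x ->
     exists y, alpha f y = c) -> is_immersion mu.
Proof.
move=> F G; split=> [v w w' f f' E|v w f].
  split=> [|D]; first exact: dcoset_out.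
  by have := twist_dcoset mu f'; rewrite -D => -[c [x]]; apply: F.
apply/seteqP; split=> x.
  move=> [_ [y _ <-] <-]; split; last by eexists.
  by exists (vhom mu v (alpha f y)); [exists (alpha f y)|rewrite -alpha_ehom].
move=> [[_ [c _ <-] <-] [a _ aE]].
have [y yE] := G _ _ f c a (esym aE).
by exists (ehom mu f y); [exists y|rewrite alpha_ehom yE].
Qed.

(** An equivalence translates all double cosets at v by a_v on the left. *)
Lemma approx_immersion (B A : gog) (mu1 mu2 : mor B A) :
  approx mu1 mu2 -> is_immersion mu1 -> is_immersion mu2.
Proof.
case: mu1 mu2 => [m d1] [m' d2] [/= h]; subst m' => /= -[a [b [bV aE abE]]] H.
have tE u v (f : edge u v) : twist d2 f = (a u)^-1 * twist d1 f * alpha (emap m f) (b u v f).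
  by rewrite (abE _ _ f) !invgM invgK -!mulgA mulKg mulVg mulg1.
apply: immersionI => [v w w' f f' c x E|v w f c x] /=.
- rewrite !tE aE conjgE -!mulgA => /mulgI; rewrite mulVKg => tf'.
  have hE : tot (emap m f') = tot (emap m f) := congr1 (existT (@outE A) (m v)) (esym E).
  apply: (imm_fold H (c := c) (x := b v w f * x * (ec hE (b v w' f'))^-1) E).
  rewrite /= !gmulfM gmulfV (alpha_ec _ erefl) vc_id.
  by rewrite -(mulgK (alpha (emap m f') (b v w' f')) (twist d1 f')) tf' !mulgA.
- rewrite tE aE -conjgM !mulgA mulgV mul1g => cE.
  have [|y yE _] := @imm_edge_group _ _ (Mor d1) H _ _ f c (x ^ (b v w f)^-1).
    by rewrite gmulfJ gmulfV /= -cE conjgM conjgK.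
  by exists y.
Qed.

(** A relation between the data of mu is mapped by nu to one for the composite,
    whose conclusions already speak of the source. *)
Lemma immersion_cancel (C B A : gog) (nu : mor B A) (mu : mor C B) :
  is_immersion (mcomp nu mu) -> is_immersion mu.
Proof.
move=> H; apply: immersionI => [v w w' f f' c x E tE|v w f c x cE].
- have E' : out (emap nu (emap mu f)) = out (emap nu (emap mu f')).
    exact: (f_equal (fun s : outE (mu v) => out (emap nu (projT2 s))) E).
  apply: (imm_fold H (c := c) (x := ehom nu (emap mu f) x) E') => /=.
  have -> : twist nu (emap mu f') = twist nu (emap mu f).
    exact: esym (f_equal (fun s : outE (mu v) => twist nu (projT2 s)) E).
  by rewrite tE alpha_ehom !gmulfM -!mulgA -conjgC.
- have [|y yE _] := @imm_edge_group _ _ _ H _ _ f c (ehom nu (emap mu f) x).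
    by rewrite /= conjgM -gmulfJ cE alpha_ehom.
  by exists y.
Qed.

End ImmersionCriterion.

Section Subgog.
Variables (X : gog) (PV : X -> Prop) (PE : allE X -> Prop).
Hypothesis PE_einv : forall (u v : X) (e : edge u v),
  PE (tot e) -> PE (tot (einv e)).

(** The restriction of a graph of groups to sets of vertices and edges.  It is
    used for the choice of representatives and for the core. *)
Definition sub_vert := {x : X | PV x}.
Definition sub_edge (p q : sub_vert) :=
  {e : edge (sval p) (sval q) | PE (tot e)}.
Definition sub_einv (p q : sub_vert) (e : sub_edge p q) : sub_edge q p :=
  exist _ (einv (sval e)) (PE_einv (svalP e)).

Lemma sub_einvK (p q : sub_vert) (e : sub_edge p q) :
  sub_einv (sub_einv e) = e.
Proof. by apply: sval_inj; rewrite /= einvK. Qed.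

Lemma sub_einv_neq (p : sub_vert) (e : sub_edge p p) : sub_einv e <> e.
Proof. by move/(congr1 sval); apply: einv_neq. Qed.

Definition sub_graph : graph := Graph sub_einvK sub_einv_neq.

Definition subgog : gog :=
  @Gog sub_graph (fun p => VG (sval p)) (fun p q e => EG (sval e))
    (fun p q e => alpha (sval e)) (fun p q e => omega (sval e))
    (fun p q e => alpha_inj (sval e)) (fun p q e => omega_inj (sval e))
    (fun p q e => eflip (e := sval e)) (fun p q e => alpha_flip (e := sval e))
    (fun p q e => omega_flip (e := sval e)).

Definition incl_graph : graph_mor subgog X :=
  @GraphMor subgog X (fun p => sval p) (fun p q e => sval e)
    (fun p q e => erefl).

Lemma incl_conj (G : groupType) (x : G) : x = x ^ 1.
Proof. by rewrite conjg1. Qed.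

Definition incl : mor subgog X :=
  Mor (@MorData subgog X incl_graph (fun p => idfun) (fun p q e => idfun)
    (fun p => @inj_id _) (fun p q e => @inj_id _) (fun p q e => 1)
    (fun p q e x => incl_conj (alpha (sval e) x))
    (fun p q e x => incl_conj (omega (sval e) x))).

Lemma sub_out (p q q' : subgog) (e : edge p q) (e' : edge p q') :
  out (sval e) = out (sval e') -> out e = out e'.
Proof.
case: q q' e e' => [x hx] [x' hx'] [e he] [e' he'] /= E.
have ? : x = x' := congr1 (@projT1 _ _) E; subst x'.
have ? := out_inj E; subst e'.
by rewrite (Prop_irrelevance hx' hx) (Prop_irrelevance he' he).
Qed.

Lemma sub_tot (p q p' q' : subgog) (e : edge p q) (e' : edge p' q') :
  tot (sval e) = tot (sval e') -> tot e = tot e'.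
Proof.
case: p p' e e' => [x hx] [x' hx'] e e' E.
have /= ? : x = x' := congr1 (@projT1 _ _) E; subst x'.
move: e'  E; rewrite (Prop_irrelevance hx' hx) => e' /tot_out/sub_out E.
exact (congr1 (fun o => existT (@outE sub_graph) _ o) E).
Qed.

Lemma incl_immersion : is_immersion incl.
Proof.
apply: immersionI => [v w w' f f' c x E _|v w f c x]; first exact: sub_out.
by rewrite /= conjg1 => ->; exists x.
Qed.

Section Factor.
Variables (Y : gog) (sigma : mor Y X).
Hypothesis sV : forall y, PV (sigma y).
Hypothesis sE : forall (x y : Y) (f : edge x y), PE (tot (emap sigma f)).

Definition factor_vmap (y : Y) : subgog := exist _ (sigma y) (sV y).
Definition factor_emap (x y : Y) (f : edge x y) :
  edge (factor_vmap x) (factor_vmap y) :=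
  exist (fun e : edge (sigma x) (sigma y) => PE (tot e)) (emap sigma f) (sE f).

Lemma factor_emapV (x y : Y) (f : edge x y) :
  factor_emap (einv f) = einv (factor_emap f).
Proof. by apply: sval_inj; rewrite /= emapV. Qed.

Definition factor : mor Y subgog :=
  Mor (@MorData Y subgog (GraphMor factor_emapV)
    (fun y => vhom sigma y : ghom (VG y) (VG (factor_vmap y)))
    (fun x y f => ehom sigma f : ghom (EG f) (EG (factor_emap f)))
    (@vhom_inj _ _ _ sigma) (@ehom_inj _ _ _ sigma)
    (fun x y f => twist sigma f) (@alpha_ehom _ _ _ sigma)
    (@omega_ehom _ _ _ sigma)).

Lemma incl_factor : approx (mcomp incl factor) sigma.
Proof.
apply: (@approx_over _ _ (mcomp incl factor) sigma sigma (fun=> erefl)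
  (fun=> erefl) (fun=> 1) (fun _ _ _ => 1)) => //.
by split=> * /=; rewrite ?conjg1 // gmulf1 !mulg1 mulgV.
Qed.
End Factor.

(** The inclusion is injective on vertices and edges and is the identity on
    groups, so equivalence of composites already equates the graph maps. *)
Lemma incl_mono (Y : gog) (s s' : mor Y subgog) :
  approx (mcomp incl s) (mcomp incl s') -> approx s s'.
Proof.
move=> H; have [V [E _]] := approx_overP H.
case: s s' H V E => [m d] [m' d'] H V E.
have ? : m = m'.
  apply: graph_mor_ext => [y|x y f]; first by apply: sval_inj; apply: V.
  exact/sub_tot/E.
subst m'; case: H => /= h; rewrite (Prop_irrelevance h erefl) => -[a [b [H1 H2 H3]]].
exists erefl => /=; exists a, b; split=> [u v f|v x|u v f].
- apply/(eflip_eqP (e := emap m f)); first by rewrite emapV.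
  by apply/(eflip_eqP (e := sval (emap m f))); [rewrite emapV|apply: H1].
- exact: H2.
- by rewrite (H3 u v f) /= !mulg1.
Qed.

Lemma path_lift (p q : subgog) (r : gpath (sval p) (sval q)) :
  (forall x, vertex_on x r -> PV x) -> (forall f, edge_on f r -> PE f) ->
  exists s : gpath p q, pmap incl s = r.
Proof.
have gen u v (r' : gpath u v) : (forall x, vertex_on x r' -> PV x) ->
    (forall f, edge_on f r' -> PE f) ->
    forall hu hv, exists s : gpath (exist _ u hu : subgog) (exist _ v hv : subgog),
      pmap incl s = r'.
  elim: r' => [x a|x y z a e r' IH] /= hV hE hu hv.
    rewrite (Prop_irrelevance hv hu).
    by exists (@path_nil subgog (exist _ x hu) a).
  have hy : PV y by apply: hV; right; case: (r') => /=; [|left].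
  have [|f Hf|s sE] := IH _ _ hy hv; first by move=> w Hw; apply: hV; right.
    by apply: hE; right.
  exists (@path_cons subgog (exist _ x hu) (exist _ y hy) (exist _ z hv) a
    (exist _ e (hE _ (or_introl erefl))) s).
  by rewrite /= sE mulg1 invg1 pmull1.
by case: p q r => [x hx] [y hy] r hV hE; apply: gen.
Qed.

Lemma reduced_incl (p q : subgog) (r : gpath p q) :
  reduced (pmap incl r) -> reduced r.
Proof.
elim: r => [u' c|u' v' w' c e r IH] //= [H1 /reduced_pmull/IH ?]; split=> //.
move=> fE [y _ yE]; apply: H1.
  rewrite first_edge_pmull; move: fE; case: (r) e {IH yE y} => //= u v w a f r' e /Some_inj E.
  exact (f_equal (fun s : @outE sub_graph u => Some (out (sval (projT2 s)))) E).
rewrite first_elt_pmull; exists y => //; rewrite yE.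
by rewrite invg1 mul1g; case: (r) => //= *; rewrite mulg1.
Qed.

Lemma vertex_on_incl (x p q : subgog) (r : gpath p q) :
  vertex_on (sval x) (pmap incl r) -> vertex_on x r.
Proof.
elim: r => [u' c|u' v' w' c e r IH] /=; first by move=> ?; apply: sval_inj.
by rewrite vertex_on_pmull => -[?|/IH]; [left; apply: sval_inj|right].
Qed.

Lemma edge_on_incl (x y : subgog) (f : edge x y) (p q : subgog) (r : gpath p q) :
  edge_on (tot (sval f)) (pmap incl r) -> edge_on (tot f) r.
Proof.
elim: r => [u' c|u' v' w' c e r IH] //=.
by rewrite edge_on_pmull => -[/sub_tot|/IH]; [left|right].
Qed.

End Subgog.

Section CoreOf.
Variable X : gog.

Lemma pinv_pcat (u v w : X) (p : gpath u v) (q : gpath v w) :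
  pinv (pcat p q) = pcat (pinv q) (pinv p).
Proof.
elim: p q => [u' c|u' v' w' c e p IH] q /=; first by rewrite pinv_pmull.
by rewrite IH pcatA.
Qed.

Lemma plength_pinv (u v : X) (p : gpath u v) : plength (pinv p) = plength p.
Proof. by elim: p => //= *; rewrite plength_pcat addn1; congr _.+1. Qed.

Lemma vertex_on_start (u v : X) (p : gpath u v) : vertex_on u p.
Proof. by case: p => //= *; left. Qed.

Lemma last_pinv (u v : X) (p : gpath u v) :
  last_elt (pinv p) = (first_elt p)^-1 /\
  forall x (e : edge x u), last_edge (pinv p) = Some (inc e) ->
    first_edge p = Some (out (einv e)).
Proof.
have from_cat (u' v' w' : X) (p1 : gpath u' v') (e : edge v' w') a d :
    last_edge_from (pcat p1 (path_cons 1 e (path_nil a))) d = inc e.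
  by elim: p1 e d => //= x y z c e' p1 IH e d; apply: IH.
have last_cat (u' v' w' : X) (p1 : gpath u' v') (e : edge v' w') a :
    last_elt (pcat p1 (path_cons 1 e (path_nil a))) = a /\
    last_edge (pcat p1 (path_cons 1 e (path_nil a))) = Some (inc e).
  split; first by elim: p1 e => //= x y z c e' p1 IH e; apply: IH.
  by case: p1 e => //= x y z c e' p1 e; rewrite from_cat.
case: p => [u' c|u' v' w' c e p] //=.
have [-> ->] := last_cat _ _ _ (pinv p) (einv e) c^-1; split=> // x e' /Some_inj E.
have /= ? : v' = x := congr1 (@projT1 _ _) E; subst x.
by have <- := inc_inj E; rewrite einvK.
Qed.

(** Needed to see that the core is closed under inversion of edges. *)
Lemma reduced_pinv (u v : X) (p : gpath u v) : reduced p -> reduced (pinv p).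
Proof.
elim: p => [u' c|u' v' w' c e p IH] //= [H1 /IH{}IH].
apply/reduced_pcat; split=> //= x e' /(last_pinv p).2 pE.
have [-> _] := last_pinv p; rewrite mulg1 => /Some_inj E.
have /= ? : u' = x := congr1 (@projT1 _ _) E; subst x.
have ee' : einv e = einv e' := out_inj E.
have := H1; rewrite pE ee' => /(_ erefl) H2 [y _ yE]; apply: H2.
have ? : e = e' by rewrite -(einvK e) ee' einvK.
by subst e'; exists y^-1; rewrite // gmulfV yE invgK.
Qed.

Lemma edge_on_pcat f (u v w : X) (p : gpath u v) (q : gpath v w) :
  edge_on f (pcat p q) <-> edge_on f p \/ edge_on f q.
Proof.
elim: p q => [u' c|u' v' w' c e p IH] q /=.
  by rewrite edge_on_pmull; split=> [|[]]; [right| |].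
by rewrite IH; tauto.
Qed.

Lemma edge_on_pinv (x y : X) (f : edge x y) (u v : X) (p : gpath u v) :
  edge_on (tot f) p -> edge_on (tot (einv f)) (pinv p).
Proof.
elim: p => [u' c|u' v' w' c e p IH] //= H; apply/edge_on_pcat.
by case: H => [/tot_einv H|/IH]; [right; left|left].
Qed.

Lemma core_edge_einv (x y : X) (f : edge x y) :
  core_edge (tot f) -> core_edge (tot (einv f)).
Proof.
move=> [u [p [p0 pr fp]]]; exists u, (pinv p).
have p0' : 0 < plength (pinv p).
  by rewrite plength_pinv.
split=> //; last exact: edge_on_pinv.
apply/cyclically_reducedE; rewrite -pinv_pcat.
exact/reduced_pinv/cyclically_reducedE.
Qed.

Definition coreX : gog := subgog (@core_vertex X) core_edge_einv.

(** A cyclically reduced circuit consists of core vertices and core edges, so it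
    lies in the core and remains cyclically reduced there. *)
Lemma coreX_core : is_core coreX.
Proof.
have lift (u : X) (p : gpath u u) : 0 < plength p -> cyclically_reduced p ->
    exists (v : coreX) (q : gpath v v), [/\ 0 < plength q, cyclically_reduced q,
      forall x : coreX, vertex_on (sval x) p -> vertex_on x q &
      forall (x y : coreX) (f : edge x y), edge_on (tot (sval f)) p -> edge_on (tot f) q].
  move=> p0 pr.
  have hu : core_vertex u.
    by exists u, p; split=> //; apply: vertex_on_start.
  have [|f Hf|q qE] := @path_lift _ _ _ core_edge_einv (exist _ u hu) (exist _ u hu) p.
  - by move=> x Hx; exists u, p.
  - by exists u, p.
  have q0 : 0 < plength q by rewrite -(plength_pmap (incl (@core_vertex X) core_edge_einv)) qE.
  exists (exist _ u hu), q; split=> //.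
  - apply/cyclically_reducedE; apply: (@reduced_incl _ _ _ core_edge_einv).
    by rewrite pmap_pcat qE; apply/cyclically_reducedE.
  - by move=> x; rewrite -qE; apply: vertex_on_incl.
  - by move=> x y f; rewrite -qE; apply: edge_on_incl.
split=> [x|[x [y f]]].
- have [u [p [p0 pr xp]]] := svalP x; have [v [q [? ? qV _]]] := lift _ _ p0 pr.
  by exists v, q; split=> //; apply: qV.
- have [u [p [p0 pr xp]]] := svalP f; have [v [q [? ? _ qE]]] := lift _ _ p0 pr.
  by exists v, q; split=> //; apply: (qE x y f).
Qed.

End CoreOf.

(** * Fibre products of groups, and morphisms read in a fixed target *)

Section FiberProduct.
Variables (G H K : groupType) (phi : ghom G K) (psi : ghom H K) (a : K).

(** For injective phi and psi, the pairs (y, z) with psi z = (phi y)^a are the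
    intersection of the image of H with the conjugate by a of the image of G. *)
Definition fib_pred : pred (G * H) := fun yz => psi yz.2 == phi yz.1 ^ a.

Lemma fib_group_closed : group_closed fib_pred.
Proof.
split; first by rewrite /in_mem /= /fib_pred /= !gmulf1 conj1g.
move=> [y z] [y' z']; rewrite /in_mem /= /fib_pred /= => /eqP E /eqP E'.
by rewrite !gmulfF /= E E' conjMg conjVg.
Qed.

Record fib := Fib { fibv :> G * H; fibP : fib_pred fibv }.
HB.instance Definition _ := [isSub for fibv].
HB.instance Definition _ := [Choice of fib by <:].
HB.instance Definition _ :=
  SubChoice_isSubGroup.Build (G * H)%type fib_pred fib fib_group_closed.

Definition mkfib y z (h : psi z = phi y ^ a) : fib :=
  Fib (introT eqP h : fib_pred (y, z)).

Lemma fib_eq (x : fib) : psi x.2 = phi x.1 ^ a.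
Proof. exact/eqP/(fibP x). Qed.

Lemma fib_ext (x x' : fib) : x.1 = x'.1 -> x.2 = x'.2 -> x = x'.
Proof. by case: x x' => [[? ?] ?] [[? ?] ?] /= ? ?; apply: val_inj => /=; congr pair. Qed.

Definition fib1 (x : fib) : G := x.1.
Definition fib2 (x : fib) : H := x.2.
Lemma fib1_morph : {morph fib1 : x y / x / y}. Proof. by []. Qed.
Lemma fib2_morph : {morph fib2 : x y / x / y}. Proof. by []. Qed.
HB.instance Definition _ := isGroupMorphism.Build fib G fib1 fib1_morph.
HB.instance Definition _ := isGroupMorphism.Build fib H fib2 fib2_morph.

Lemma fib1_inj : injective psi -> injective fib1.
Proof.
move=> psi_inj x x' E; apply: fib_ext => //; apply: psi_inj.
by rewrite !fib_eq (E : x.1 = x'.1).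
Qed.

Lemma fib2_inj : injective phi -> injective fib2.
Proof.
move=> phi_inj x x' E; apply: fib_ext => //; apply: phi_inj.
by apply: (@conjg_inj _ a); rewrite -!fib_eq (E : x.2 = x'.2).
Qed.

End FiberProduct.
Arguments fib1 {G H K phi psi a} x.
Arguments fib2 {G H K phi psi a} x.

Section FiberMap.
Variables (L G H K : groupType) (phi : ghom G K) (psi : ghom H K) (a : K).
Variables (h : ghom L G) (k : ghom L H).
Hypothesis hk : forall x, psi (k x) = phi (h x) ^ a.

Definition fib_pair (x : L) : fib phi psi a := mkfib (hk x).

Lemma fib_pair_morph : {morph fib_pair : x y / x / y}.
Proof. by move=> x y; apply: fib_ext; rewrite /= gmulfF. Qed.
HB.instance Definition _ := isGroupMorphism.Build L (fib phi psi a) fib_pair fib_pair_morph.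

Definition fib_hom : ghom L (fib phi psi a) := fib_pair.

End FiberMap.

Section Conj.
Variables (G : groupType) (g : G).
Definition conj_by (x : G) := x ^ g.
Lemma conj_by_morph : {morph conj_by : x y / x / y}.
Proof. by move=> x y; rewrite /conj_by conjMg conjVg. Qed.
HB.instance Definition _ := isGroupMorphism.Build G G conj_by conj_by_morph.
End Conj.

Section Frames.
Variables (B A : gog) (mu : mor B A).

(** The homomorphisms and twisting elements of mu over vertices u and edges e of
    A that are only propositionally the images of v and f.  For two morphisms
    into A this provides a common target without reference to either. *)
Definition fhom (v : B) (u : A) (h : mu v = u) : ghom (VG v) (VG u) :=
  vc h \o vhom mu v.
Definition ftw (v w : B) (u : A) (h : mu v = u) (f : edge v w) : VG u :=
  vc h (twist mu f).
Definition fehom (v w : B) (u u' : A) (f : edge v w) (e : edge u u')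
    (h : tot (emap mu f) = tot e) : ghom (EG f) (EG e) :=
  ec h \o ehom mu f.

Lemma fhom_inj v u (h : mu v = u) : injective (fhom h).
Proof. by move=> x y /vc_inj/(@vhom_inj _ _ _ mu). Qed.

Lemma fehom_inj v w u u' (f : edge v w) (e : edge u u')
  (h : tot (emap mu f) = tot e) : injective (fehom h).
Proof. by move=> x y /ec_inj/(@ehom_inj _ _ _ mu). Qed.

Lemma fehom_alpha v w u u' (f : edge v w) (e : edge u u')
    (h : tot (emap mu f) = tot e) (k : mu v = u) x :
  alpha e (fehom h x) = fhom k (alpha f x) ^ ftw k f.
Proof. by rewrite /= (alpha_ec _ k) alpha_ehom gmulfJ. Qed.

Lemma fehom_omega v w u u' (f : edge v w) (e : edge u u')
    (h : tot (emap mu f) = tot e) (k : mu w = u') x :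
  omega e (fehom h x) = fhom k (omega f x) ^ ftw k (einv f).
Proof. by rewrite /= (omega_ec _ k) omega_ehom gmulfJ. Qed.

Lemma frame_einv v w u u' (f : edge v w) (e : edge u u') :
  tot (emap mu f) = tot e -> tot (emap mu (einv f)) = tot (einv e).
Proof. by move=> h; rewrite emapV; apply: tot_einv. Qed.

Lemma fehom_flip v w u u' (f : edge v w) (e : edge u u')
    (h : tot (emap mu f) = tot e) (h' : tot (emap mu (einv f)) = tot (einv e))
    (k : mu w = u') x :
  fehom h' (eflip x) = eflip (fehom h x).
Proof.
by apply: (alpha_inj (einv e)); rewrite (fehom_alpha _ k) !alpha_flip (fehom_omega _ k).
Qed.

Hypothesis mu_imm : is_immersion mu.

(** [imm_edge_group] and [imm_fold] in this setting. *)
Lemma frame_edge_group v w u u' (f : edge v w) (e : edge u u')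
    (h : tot (emap mu f) = tot e) (k : mu v = u) c x :
  fhom k c ^ ftw k f = alpha e x -> exists2 y, alpha f y = c & fehom h y = x.
Proof.
subst u; move=> E.
have {}E : vhom mu v c ^ twist mu f = alpha (emap mu f) (ec (esym h) x).
  by rewrite (alpha_ec _ erefl) vc_id -E.
have [y yc yE] := imm_edge_group mu_imm E; exists y => //.
by rewrite /fehom /= yE ecK.
Qed.

Lemma frame_fold v w w' u u' (f : edge v w) (f' : edge v w') (e : edge u u')
    (h : tot (emap mu f) = tot e) (h' : tot (emap mu f') = tot e)
    (k : mu v = u) c x :
  ftw k f' = fhom k c * ftw k f * alpha e x -> out f = out f'.
Proof.
subst u; move=> E; apply: (imm_fold mu_imm (c := c) (x := ec (esym h) x)).
  by apply: tot_out; rewrite h.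
by rewrite (alpha_ec _ erefl).
Qed.

End Frames.

Lemma fhom_vc (B A : gog) (mu : mor B A) (v v' : B) (u u' : A) (h : v' = v)
    (k : mu v = u) (k' : mu v' = u') (hu : u' = u) t :
  fhom k (vc h t) = vc hu (fhom k' t).
Proof. by subst v u u'; rewrite (Prop_irrelevance hu erefl). Qed.

Lemma ftw_vc (B A : gog) (mu : mor B A) (v v' w w' : B) (u u' : A)
    (f : edge v w) (f' : edge v' w') (h : tot f' = tot f)
    (k : mu v = u) (k' : mu v' = u') (hu : u' = u) :
  vc hu (ftw k' f') = ftw k f.
Proof.
move: v w f h k; apply: tot_ind => k.
by rewrite /ftw (vc_trans _ _ k).
Qed.

(** * The graph of groups of all matching data *)

Section Raw.
Variables (A B C : gog) (muB : mor B A) (muC : mor C A).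

(** Besides v, w and a, a vertex records their common image u in A, so that B
    and C play symmetric roles.  The elements of an edge are beta = [rbo] and
    kappa = [rco] at the origin, [rbt] and [rct] at the terminus. *)
Record rvert := RVert {
  ru : A; rv : B; rw : C;
  rhv : muB rv = ru; rhw : muC rw = ru;
  ra : VG ru }.

Record redge (p q : rvert) := REdge {
  re : edge (ru p) (ru q);
  rf : edge (rv p) (rv q);
  rg : edge (rw p) (rw q);
  rhf : tot (emap muB rf) = tot re;
  rhg : tot (emap muC rg) = tot re;
  rx : EG re;
  rbo : VG (rv p); rco : VG (rw p);
  rbt : VG (rv q); rct : VG (rw q);
  rPo : ra p = fhom (rhv p) rbo * ftw (rhv p) rf * alpha re rx
               * (ftw (rhw p) rg)^-1 * (fhom (rhw p) rco)^-1;
  rPt : ra q = fhom (rhv q) rbt * ftw (rhv q) (einv rf) * omega re rx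
               * (ftw (rhw q) (einv rg))^-1 * (fhom (rhw q) rct)^-1 }.

Lemma redge_ext (p q : rvert) (s s' : redge p q) :
  rf s = rf s' -> rg s = rg s' ->
  alpha (re s) (rx s) = alpha (re s') (rx s') ->
  rbo s = rbo s' -> rco s = rco s' -> rbt s = rbt s' -> rct s = rct s' ->
  s = s'.
Proof.
case: s s' => [e f g hf hg x b c b' c' P P'] [e1 f1 g1 hf1 hg1 x1 b1 c1 b1' c1' P1 P1'] /=.
move=> ? ?; subst f1 g1; have ? : e = e1 by apply: tot_inj; rewrite -hf.
subst e1 => /alpha_inj ? ? ? ? ?; subst x1 b1 c1 b1' c1'.
by rewrite (Prop_irrelevance hf1 hf) (Prop_irrelevance hg1 hg)
  (Prop_irrelevance P1 P) (Prop_irrelevance P1' P').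
Qed.

Definition rinv (p q : rvert) (s : redge p q) : redge q p.
Proof.
refine (@REdge q p (einv (re s)) (einv (rf s)) (einv (rg s))
  (frame_einv (rhf s)) (frame_einv (rhg s)) (eflip (rx s))
  (rbt s) (rct s) (rbo s) (rco s) _ _).
- by rewrite alpha_flip; apply: rPt.
- by rewrite omega_flip !einvK; apply: rPo.
Defined.

Lemma rinvK (p q : rvert) (s : redge p q) : rinv (rinv s) = s.
Proof. by apply: redge_ext; rewrite //= ?einvK // alpha_flip omega_flip. Qed.

Lemma rinv_neq (p : rvert) (s : redge p p) : rinv s <> s.
Proof. by move/(congr1 (@rf p p)); apply: einv_neq. Qed.

Definition rgraph : graph := Graph rinvK rinv_neq.

Definition rVG (p : rvert) : groupType :=
  fib (fhom (rhv p)) (fhom (rhw p)) (ra p).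
Definition rEG (p q : rvert) (s : redge p q) : groupType :=
  fib (fehom (rhf s)) (fehom (rhg s)) (rx s).

(** The map alpha of an edge of the raw graph, conjugation by beta^-1 and
    kappa^-1 after the maps of B and C, lands in the fibre product at the
    origin. *)
Lemma conj_chain (G : groupType) (a b c f g x y z : G) :
  a = b * f * x * g^-1 * c^-1 -> z ^ g = (y ^ f) ^ x ->
  z ^ c^-1 = (y ^ b^-1) ^ a.
Proof. by move=> -> E; rewrite !conjgM conjgKV -E conjgK. Qed.

Section EdgeMaps.
Variables (p q : rvert) (s : redge p q).

Lemma ralpha_subproof (y : rEG s) :
  fhom (rhw p) ((conj_by (rco s)^-1 \o (alpha (rg s) \o fib2)) y) =
  fhom (rhv p) ((conj_by (rbo s)^-1 \o (alpha (rf s) \o fib1)) y) ^ ra p.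
Proof.
rewrite [LHS](gmulfJ (fhom _)) [in RHS](gmulfJ (fhom _)) !gmulfV.
apply: conj_chain (rPo s) _.
by rewrite -(fehom_alpha (rhf s)) -(fehom_alpha (rhg s)) -gmulfJ -fib_eq.
Qed.

Lemma romega_subproof (y : rEG s) :
  fhom (rhw q) ((conj_by (rct s)^-1 \o (omega (rg s) \o fib2)) y) =
  fhom (rhv q) ((conj_by (rbt s)^-1 \o (omega (rf s) \o fib1)) y) ^ ra q.
Proof.
rewrite [LHS](gmulfJ (fhom _)) [in RHS](gmulfJ (fhom _)) !gmulfV.
apply: conj_chain (rPt s) _.
by rewrite -(fehom_omega (rhf s)) -(fehom_omega (rhg s)) -gmulfJ -fib_eq.
Qed.

Definition ralpha : ghom (rEG s) (rVG p) := fib_hom ralpha_subproof.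
Definition romega : ghom (rEG s) (rVG q) := fib_hom romega_subproof.

Lemma ralpha_inj : injective ralpha.
Proof.
move=> y y' E; apply: fib_ext.
- exact/(alpha_inj (rf s))/(@conjg_inj _ (rbo s)^-1)/(congr1 fib1 E).
- exact/(alpha_inj (rg s))/(@conjg_inj _ (rco s)^-1)/(congr1 fib2 E).
Qed.

Lemma romega_inj : injective romega.
Proof.
move=> y y' E; apply: fib_ext.
- exact/(omega_inj (rf s))/(@conjg_inj _ (rbt s)^-1)/(congr1 fib1 E).
- exact/(omega_inj (rg s))/(@conjg_inj _ (rct s)^-1)/(congr1 fib2 E).
Qed.

Lemma rflip_subproof (y : rEG s) :
  fehom (rhg (rinv s)) (eflip y.2)
  = fehom (rhf (rinv s)) (eflip y.1) ^ rx (rinv s).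
Proof.
rewrite (fehom_flip (rhf s) _ (rhv q)) (fehom_flip (rhg s) _ (rhw q)) fib_eq.
by apply: (alpha_inj (einv (re s))); rewrite gmulfJ !alpha_flip gmulfJ.
Qed.

Definition rflip (y : rEG s) : rEG (rinv s) := mkfib (rflip_subproof y).

End EdgeMaps.

Lemma ralpha_flip (p q : rvert) (s : redge p q) (y : rEG s) :
  ralpha (rinv s) (rflip y) = romega s y.
Proof. by apply: fib_ext; rewrite /= /conj_by /= alpha_flip. Qed.

Lemma romega_flip (p q : rvert) (s : redge p q) (y : rEG s) :
  romega (rinv s) (rflip y) = ralpha s y.
Proof. by apply: fib_ext; rewrite /= /conj_by /= omega_flip. Qed.

Definition rawgog : gog :=
  @Gog rgraph rVG rEG ralpha romega ralpha_inj romega_inj rflip ralpha_flip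
    romega_flip.

(** The projections to B and C, and the common graph map to A. *)
Definition rawB_graph : graph_mor rawgog B :=
  @GraphMor rawgog B rv (fun p q s => rf (s : redge p q)) (fun p q s => erefl).
Definition rawC_graph : graph_mor rawgog C :=
  @GraphMor rawgog C rw (fun p q s => rg (s : redge p q)) (fun p q s => erefl).
Definition rawA_graph : graph_mor rawgog A :=
  @GraphMor rawgog A ru (fun p q s => re (s : redge p q)) (fun p q s => erefl).

Lemma conjV_by (G : groupType) (x y : G) : x = conj_by y^-1 x ^ y.
Proof. by rewrite /conj_by conjgKV. Qed.

Definition rawB : mor rawgog B :=
  Mor (@MorData rawgog B rawB_graph
    (fun p => fib1 : ghom (rVG p) (VG (rv p)))
    (fun p q s => fib1 : ghom (rEG s) (EG (rf s)))
    (fun p => fib1_inj (@fhom_inj _ _ _ _ _ (rhw p)))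
    (fun p q s => fib1_inj (@fehom_inj _ _ _ _ _ _ _ _ _ (rhg s)))
    (fun p q s => rbo s)
    (fun p q s y => conjV_by (alpha (rf s) (fib1 y)) (rbo s))
    (fun p q s y => conjV_by (omega (rf s) (fib1 y)) (rbt s))).

Definition rawC : mor rawgog C :=
  Mor (@MorData rawgog C rawC_graph
    (fun p => fib2 : ghom (rVG p) (VG (rw p)))
    (fun p q s => fib2 : ghom (rEG s) (EG (rg s)))
    (fun p => fib2_inj (@fhom_inj _ _ _ _ _ (rhv p)))
    (fun p q s => fib2_inj (@fehom_inj _ _ _ _ _ _ _ _ _ (rhf s)))
    (fun p q s => rco s)
    (fun p q s y => conjV_by (alpha (rg s) (fib2 y)) (rco s))
    (fun p q s y => conjV_by (omega (rg s) (fib2 y)) (rct s))).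

(** The equations stored in vertices and edges are those of an equivalence. *)
Lemma raw_over : over (m := rawA_graph) (mu1 := mcomp muB rawB)
  (mu2 := mcomp muC rawC) rhv rhw ra (fun p q s => rx (s : redge p q)).
Proof.
split=> [p y|p q s|p q s].
- exact (@fib_eq _ _ _ (fhom (rhv p)) (fhom (rhw p)) (ra p) y).
- rewrite /= !gmulfM invgM !mulgA; exact: rPo.
- rewrite /= !gmulfM invgM !mulgA; exact: rPt.
Qed.

Lemma raw_comm : approx (mcomp muB rawB) (mcomp muC rawC).
Proof.
apply: (approx_over _ _ raw_over) => p q s; [exact: rhf|exact: rhg].
Qed.

Section Pairing.
Variables (X : gog) (sB : mor X B) (sC : mor X C) (m : graph_mor X A).
Variables (VB : forall x, muB (sB x) = m x) (VC : forall x, muC (sC x) = m x).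
Hypothesis EB : forall x y (f : edge x y), tot (emap muB (emap sB f)) = tot (emap m f).
Hypothesis EC : forall x y (f : edge x y), tot (emap muC (emap sC f)) = tot (emap m f).
Variables (a : forall x, VG (m x)) (b : forall x y (f : edge x y), EG (emap m f)).
Hypothesis H : over (mu1 := mcomp muB sB) (mu2 := mcomp muC sC) VB VC a b.

Definition pair_vmap (x : X) : rawgog := RVert (VB x) (VC x) (a x).

Definition pair_emap (x y : X) (f : edge x y) :
  edge (pair_vmap x) (pair_vmap y).
Proof.
refine (@REdge (pair_vmap x) (pair_vmap y) (emap m f) (emap sB f) (emap sC f)
  (EB f) (EC f) (b f) (twist sB f) (twist sC f) (twist sB (einv f))
  (twist sC (einv f)) _ _).
- case: H => _ HT _; have := HT _ _ f.
  by rewrite /= !gmulfM invgM !mulgA.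
- case: H => _ _ HT; have := HT _ _ f.
  by rewrite /= !gmulfM invgM !mulgA !emapV.
Defined.

Lemma pair_emapV (x y : X) (f : edge x y) :
  pair_emap (einv f) = einv (pair_emap f).
Proof.
apply: redge_ext; rewrite //= ?emapV ?einvK // alpha_flip.
case: H => _ HT HT'; have := HT _ _ (einv f); rewrite (HT' _ _ f).
by move/mulIg/mulgI.
Qed.

Lemma pair_vhomP (x : X) (y : VG x) :
  fhom (VC x) (vhom sC x y) = fhom (VB x) (vhom sB x y) ^ a x.
Proof. by case: H => HV _ _; apply: HV. Qed.

(** The twisting of the two composites over A differs by b, so this follows from
    the vertex case by injectivity of alpha. *)
Lemma pair_ehomP (x y : X) (f : edge x y) (z : EG f) :
  fehom (EC f) (ehom sC f z) = fehom (EB f) (ehom sB f z) ^ b f.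
Proof.
apply: (alpha_inj (emap m f)).
rewrite gmulfJ (fehom_alpha _ (VC x)) (fehom_alpha _ (VB x)) !alpha_ehom.
case: H => HV HT _.
have E := HV x (alpha f z); have {}HT := HT _ _ f.
rewrite !(gmulfJ (fhom _)) -!conjgM.
have -> : fhom (VC x) (vhom sC x (alpha f z)) = fhom (VB x) (vhom sB x (alpha f z)) ^ a x by [].
rewrite -conjgM HT /= !gmulfM !invgM; congr (_ ^ _).
by rewrite -!mulgA; congr (_ * (_ * _)); rewrite mulKg mulVg mulg1.
Qed.

Definition pair_mor_data : mor_data (GraphMor pair_emapV : graph_mor X rawgog).
Proof.
refine (@MorData X rawgog (GraphMor pair_emapV)
  (fun x => fib_hom (@pair_vhomP x) : ghom _ (rVG (pair_vmap x)))
  (fun x y f => fib_hom (@pair_ehomP x y f) : ghom _ (rEG (pair_emap f)))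
  _ _ (fun _ _ _ => 1) _ _).
- by move=> x y y' /(congr1 fib1)/(@vhom_inj _ _ _ sB).
- by move=> x y f z z' /(congr1 fib1)/(@ehom_inj _ _ _ sB).
- move=> x y f z; rewrite conjg1; apply: fib_ext;
    by rewrite /= /conj_by /= alpha_ehom conjgK.
- move=> x y f z; rewrite conjg1; apply: fib_ext;
    by rewrite /= /conj_by /= omega_ehom conjgK.
Defined.

Definition pairing : mor X rawgog := Mor pair_mor_data.

Lemma rawB_pairing : approx (mcomp rawB pairing) sB.
Proof.
apply: (@approx_over _ _ (mcomp rawB pairing) sB sB (fun=> erefl)
  (fun=> erefl) (fun=> 1) (fun _ _ _ => 1)) => //.
by split=> * /=; rewrite ?conjg1 // gmulf1 !mulg1 ?mul1g ?emapV mulgV.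
Qed.

Lemma rawC_pairing : approx (mcomp rawC pairing) sC.
Proof.
apply: (@approx_over _ _ (mcomp rawC pairing) sC sC (fun=> erefl)
  (fun=> erefl) (fun=> 1) (fun _ _ _ => 1)) => //.
by split=> * /=; rewrite ?conjg1 // gmulf1 !mulg1 ?mul1g ?emapV mulgV.
Qed.

End Pairing.

Lemma raw_universal (X : gog) (sB : mor X B) (sC : mor X C) :
  approx (mcomp muB sB) (mcomp muC sC) ->
  exists s : mor X rawgog, approx (mcomp rawB s) sB /\ approx (mcomp rawC s) sC.
Proof.
move=> /approx_overP[V [E [a [b H]]]].
by exists (pairing E (fun _ _ _ => erefl) H); split;
  [apply: rawB_pairing|apply: rawC_pairing].
Qed.

End Raw.

(** * Choosing one vertex and one edge per double coset *)

(** The choice depends on the equivalence class as a predicate only. *)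
Lemma canonical_choice (T : Type) (R : T -> T -> Prop) :
  (forall x, R x x) -> (forall x y, R x y -> R y x) ->
  (forall x y z, R x y -> R y z -> R x z) ->
  exists can : T -> T, (forall x, R x (can x)) /\
                       (forall x y, R x y -> can x = can y).
Proof.
move=> Rr Rs Rt; have ex x : exists y, R x y by exists x.
exists (fun x => sval (cid (ex x))); split=> [x|x y xy].
  exact: svalP (cid (ex x)).
have E : R x = R y.
  by apply: funext => z; apply: propext; split; apply: Rt => //; apply: Rs.
move: (ex x) (ex y); rewrite E => h h'.
by rewrite (Prop_irrelevance h h').
Qed.

(** Also for edges that are not loops, whose inverse lives in another type. *)
Lemma tot_einv_neq (G : graph) (u v : G) (e : edge u v) :
  tot (einv e) <> tot e.
Proof.
move=> E; have ? : v = u := congr1 (@projT1 _ _) E; subst v.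
by have := tot_inj E; apply: einv_neq.
Qed.

Lemma flipEK (G : graph) : involutive (@flipE G).
Proof. by move=> [u [v e]]; rewrite /flipE /= einvK. Qed.

Lemma orientation (G : graph) : exists O : allE G -> Prop,
  forall u v (e : edge u v), O (tot (einv e)) <-> ~ O (tot e).
Proof.
have [||x y z|can [can1 can2]] :=
    @canonical_choice (allE G) (fun t t' => t = t' \/ t = flipE t').
- by left.
- by move=> x y [->|->]; [left|right; rewrite flipEK].
- by move=> [->|->] [->|->]; [left|right|right|left; rewrite flipEK].
exists (fun t => can t = t) => u v e.
have E : can (tot (einv e)) = can (tot e) by apply: can2; right.
rewrite E; have [tE|tE] := can1 (tot e).
- by rewrite -tE; split=> [/esym/tot_einv_neq//|]; case.
- split=> [-> /tot_einv_neq //|_].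
  by rewrite -[RHS]/(flipE (tot e)) tE flipEK -tE.
Qed.

(** For data on edges whose flip is defined up to a symmetric relation, one
    chooses a pair of related data on each positive edge of an orientation and
    distributes it to the edge and to its inverse. *)
Lemma coherent_choice (G : graph) (W : forall u v : G, edge u v -> Type)
    (Fl : forall (u v : G) (e : edge u v) (e' : edge v u), W u v e -> W v u e' -> Prop) :
  (forall u v (e : edge u v) (e' : edge v u) w w',
     Fl u v e e' w w' -> Fl v u e' e w' w) ->
  (forall u v (e : edge u v), exists w w', Fl u v e (einv e) w w') ->
  exists w : forall u v (e : edge u v), W u v e,
    forall u v (e : edge u v), Fl u v e (einv e) (w u v e) (w v u (einv e)).
Proof.
move=> Fsym Fex; have [O OP] := orientation G.
have {}Fex u v (e : edge u v) : exists ww : W u v e * W v u (einv e),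
    Fl u v e (einv e) ww.1 ww.2.
  by have [w [w' H]] := Fex u v e; exists (w, w').
pose pr u v e := sval (cid (Fex u v e)).
have prP u v e : Fl u v e (einv e) (pr u v e).1 (pr u v e).2.
  exact: svalP (cid (Fex u v e)).
exists (fun u v e => if pselect (O (tot e)) is left _ then (pr u v e).1
  else ecast e' (W u v e') (einvK e) (pr v u (einv e)).2) => u v e.
case: pselect => Oe; case: pselect => Oe'.
- by have := (OP _ _ e).1 Oe'.
(* The pair chosen for the twice inverted edge is compared along [einvK]. *)
- have gen e1 (h : e1 = e) (k : einv e1 = einv e) :
      Fl u v e (einv e) (pr u v e).1 (ecast e' (W v u e') k (pr u v e1).2).
    by subst e1; rewrite (Prop_irrelevance k erefl).
  exact: gen (einvK e) _.
- have gen e2 (h : einv (einv e) = e2) :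
      Fl v u (einv e) e2 (pr v u (einv e)).1 (ecast e' (W u v e') h (pr v u (einv e)).2).
    by subst e2.
  by apply: Fsym; apply: gen.
- by have := (OP _ _ e).2 Oe.
Qed.

Section Canonical.
Variables (A B C : gog) (muB : mor B A) (muC : mor C A).
Let R := rawgog muB muC.

(** The double coset of a, with explicit factors: keeping u, v, w fixed makes the
    vertex group of the moved vertex comparable without transport. *)
Definition rmove (p : R) (b : VG (rv p)) (c : VG (rw p)) : R :=
  RVert (rhv p) (rhw p) ((fhom (rhv p) b)^-1 * ra p * fhom (rhw p) c).

Definition vsim (p q : R) : Prop := exists b c, q = @rmove p b c.

Lemma rmove1 (p : R) : @rmove p 1 1 = p.
Proof.
by case: p => u v w hv hw a; rewrite /rmove !gmulf1 invg1 mul1g mulg1.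
Qed.

Lemma rmoveM (p : R) b c b' c' :
  @rmove (@rmove p b c) b' c' = @rmove p (b * b') (c * c').
Proof. by rewrite /rmove !gmulfM invgM !mulgA. Qed.

Lemma canonical_vertices : exists (kb : forall p : R, VG (rv p))
    (kc : forall p : R, VG (rw p)),
  forall p q, vsim p q -> rmove (kb p) (kc p) = rmove (kb q) (kc q).
Proof.
have [||x y z|can [can1 can2]] := @canonical_choice R vsim.
- by move=> p; exists 1, 1; rewrite rmove1.
- by move=> p q [b [c ->]]; exists b^-1, c^-1; rewrite rmoveM !mulgV rmove1.
- by move=> [b [c ->]] [b' [c' ->]]; exists (b * b'), (c * c'); rewrite rmoveM.
have {}can1 p : exists bc : VG (rv p) * VG (rw p), can p = rmove bc.1 bc.2.
  by have [b [c E]] := can1 p; exists (b, c).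
exists (fun p => (sval (cid (can1 p))).1), (fun p => (sval (cid (can1 p))).2).
by move=> p q /can2; case: cid => ? /= ->; case: cid => ? /= ->.
Qed.

(** The same f and g, and x in the same double coset.  The elements x of s and s'
    live over different edges of A until re s = re s' is known; their images
    under alpha can be compared at once. *)
Definition esim (p q : R) (s s' : redge p q) : Prop :=
  [/\ rf s = rf s', rg s = rg s' & exists n m,
      alpha (re s') (rx s')
      = alpha (re s) ((fehom (rhf s) n)^-1 * rx s * fehom (rhg s) m)].

Lemma esim_refl (p q : R) (s : redge p q) : esim s s.
Proof. by split=> //; exists 1, 1; rewrite !gmulf1 invg1 mul1g mulg1. Qed.

Lemma esim_sym (p q : R) (s s' : redge p q) : esim s s' -> esim s' s.
Proof.
case: s s' => [e f g hf hg x b c b' c' P P'] [e1 f1 g1 hf1 hg1 x1 b1 c1 b1' c1' P1 P1'] [/=].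
move=> ? ?; subst f1 g1; have ? : e = e1 by apply: tot_inj; rewrite -hf.
subst e1 => -[n [m /alpha_inj xE]].
rewrite (Prop_irrelevance hf1 hf) (Prop_irrelevance hg1 hg).
split=> //=; exists n^-1, m^-1; rewrite xE !gmulfV.
by rewrite invgK !mulgA mulgV mul1g mulgK.
Qed.

Lemma esim_trans (p q : R) (s s' s'' : redge p q) :
  esim s s' -> esim s' s'' -> esim s s''.
Proof.
case: s s' => [e f g hf hg x b c b' c' P P'] [e1 f1 g1 hf1 hg1 x1 b1 c1 b1' c1' P1 P1'] [/=].
move=> ? ?; subst f1 g1; have ? : e = e1 by apply: tot_inj; rewrite -hf.
subst e1 => -[n [m /alpha_inj xE]].
rewrite (Prop_irrelevance hf1 hf) (Prop_irrelevance hg1 hg).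
move=> [fE gE [n' [m' E]]]; split=> //=; rewrite E /=; exists (n * n'), (m * m').
by congr (alpha e _); rewrite xE !gmulfM invgM !mulgA.
Qed.

Lemma esim_rinv (p q : R) (s s' : redge p q) :
  esim s s' -> esim (rinv s) (rinv s').
Proof.
case: s s' => [e f g hf hg x b c b' c' P P'] [e1 f1 g1 hf1 hg1 x1 b1 c1 b1' c1' P1 P1'] [/=].
move=> ? ?; subst f1 g1; have ? : e = e1 by apply: tot_inj; rewrite -hf.
subst e1 => -[n [m /alpha_inj xE]].
split=> //=; exists (eflip n), (eflip m).
have /= -> := fehom_flip hf (frame_einv hf) (rhv q) n.
have /= -> := fehom_flip hg (frame_einv hg) (rhw q) m.
by rewrite !gmulfM gmulfV !alpha_flip xE !gmulfM gmulfV.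
Qed.

Definition tsim (t t' : allE R) : Prop := exists (p q : R) (s s' : redge p q),
  [/\ t = @tot R p q s, t' = @tot R p q s' & esim s s'].

Lemma tsim_sym t t' : tsim t t' -> tsim t' t.
Proof. by move=> [p [q [s [s' [-> -> /esim_sym H]]]]]; exists p, q, s', s. Qed.

Lemma tsim_trans t t' t'' : tsim t t' -> tsim t' t'' -> tsim t t''.
Proof.
move=> [p [q [s [s' [-> -> H]]]]] [p1 [q1 [s1 [s1' [E -> H1]]]]].
have ? : p = p1 := congr1 (@projT1 _ _) E; subst p1.
have ? : q = q1 := congr1 (@projT1 _ _) (tot_out E); subst q1.
have ? := @tot_inj R _ _ _ _ E; subst s1.
by exists p, q, s, s1'; split=> //; apply: esim_trans H H1.
Qed.

Lemma tsim_flip t t' : tsim t t' -> tsim (flipE t) (flipE t').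
Proof.
move=> [p [q [s [s' [-> -> /esim_rinv H]]]]].
by exists q, p, (rinv s), (rinv s').
Qed.

(** Representatives are chosen for classes closed under inversion, and the chosen
    edge and its inverse are both kept.  They are never related, because an
    edge f of B differs from its inverse. *)
Lemma canonical_edges : exists PE : allE R -> Prop,
  [/\ forall (p q : R) (s : edge p q), PE (tot s) -> PE (tot (einv s)),
      forall (p q : R) (s : edge p q), exists s' : edge p q,
        esim s s' /\ PE (tot s') &
      forall (p q : R) (s s' : edge p q), esim s s' -> PE (tot s) ->
        PE (tot s') -> s = s'].
Proof.
have tr t : tsim t t.
  by case: t => [p [q s]]; exists p, q, s, s; split=> //; apply: esim_refl.
have [||x y z|can [can1 can2]] :=
    @canonical_choice (allE R) (fun t t' => tsim t t' \/ tsim t (flipE t')).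
- by left.
- move=> x y [/tsim_sym|/tsim_sym/tsim_flip]; first by left.
  by rewrite flipEK; right.
- move=> [H|H] [H'|H'].
  + by left; apply: tsim_trans H H'.
  + by right; apply: tsim_trans H H'.
  + by right; apply: tsim_trans H (tsim_flip H').
  + by left; apply: tsim_trans H _; rewrite -[z]flipEK; apply: tsim_flip.
have canF t : can (flipE t) = can t by apply: can2; right; apply: tr.
exists (fun t => t = can t \/ flipE t = can t); split.
- move=> p q s; rewrite -[tot (einv s)]/(flipE (tot s)) flipEK canF.
  by case; [right|left].
- move=> p q s; have [|] := can1 (tot s).
  + move=> [p1 [q1 [s1 [s2 [E E2 H]]]]].
    have ? : p = p1 := congr1 (@projT1 _ _) E; subst p1.
    have ? : q = q1 := congr1 (@projT1 _ _) (tot_out E); subst q1.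
    have ? := @tot_inj R _ _ _ _ E; subst s1.
    exists s2; split=> //; left; rewrite -E2; apply: can2; left.
    by exists p, q, s, s2.
  + move=> [p1 [q1 [s1 [s2 [E E2 H]]]]].
    have ? : p = p1 := congr1 (@projT1 _ _) E; subst p1.
    have ? : q = q1 := congr1 (@projT1 _ _) (tot_out E); subst q1.
    have ? := @tot_inj R _ _ _ _ E; subst s1.
    exists s2; split=> //; right; rewrite -E2 flipEK; apply: can2; left.
    by exists p, q, s, s2.
- move=> p q s s' H cs cs'.
  have E : can (tot s) = can (tot s') by apply: can2; left; exists p, q, s, s'.
  (* s and s' have the same component in B, so s' is not the inverse of s. *)
  have HF : tot s' <> flipE (tot s).
    case: H => /= fE _ _ E'.
    have := f_equal (fun t : allE R => tot (rf (projT2 (projT2 t) : redge _ _))) E'.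
    by rewrite /= -fE => /esym; apply: tot_einv_neq.
  apply: (@tot_inj R); rewrite E in cs.
  case: cs cs' => [cs|cs] [cs'|cs'].
  + by rewrite cs -cs'.
  + by case: HF; rewrite cs -cs' flipEK.
  + by case: HF; rewrite cs'.
  + by rewrite -[LHS]flipEK cs -cs' flipEK.
Qed.

End Canonical.

(** * The subgraph of representatives *)

Section GroupIdentities.
Variable G : groupType.
Implicit Types a b c f g x y z n : G.

(** The equations a = beta f x g^-1 kappa^-1 of two edges at the same origin (with
    the same f) transfer a relation between the twisting elements over B, up to
    y, to one between g and g2 over C. *)
Lemma transfer_twist a b c f g x b2 c2 x2 g2 y z n N :
  a = b * f * x * g^-1 * c^-1 -> a = b2 * f * x2 * g2^-1 * c2^-1 ->
  b2 = y * b * n -> N = n ^ f -> z = y ^ a ->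
  g2 = c2^-1 * z * c * g * (x^-1 * N * x2).
Proof.
move=> E E2 b2E NE zE.
have -> : z = a^-1 * y * a by rewrite zE conjgE mulgA.
have -> : g2 = c2^-1 * a^-1 * b2 * f * x2.
  by rewrite E2 !invgM !invgK !mulgA; group_cancel.
rewrite NE b2E conjgE {3}E.
by rewrite !mulgA; group_cancel.
Qed.

Lemma transfer_conj a b c f g x y z N :
  a = b * f * x * g^-1 * c^-1 -> z = y ^ a -> N = (y ^ b) ^ f ->
  (z ^ c) ^ g = N ^ x.
Proof. by move=> -> -> ->; rewrite -!conjgM !mulgA; group_cancel. Qed.

(** Compares an edge with its representative: a has moved by kb and kc, and x by N
    and M.  It says that the correcting elements over B and C form a pair in
    the fibre product at the representative of the origin. *)
Lemma transfer_fiber a b c f g x kb kc b2 c2 n m N M :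
  a = b * f * x * g^-1 * c^-1 ->
  kb^-1 * a * kc = b2 * f * (N^-1 * x * M) * g^-1 * c2^-1 ->
  N = n ^ f -> M = m ^ g ->
  kc^-1 * c * m * c2^-1 = (kb^-1 * b * n * b2^-1) ^ (kb^-1 * a * kc).
Proof.
move=> aE E NE ME; apply: (mulgI (kb^-1 * a * kc)); rewrite -conjgC {2}E aE NE ME !conjgE.
by rewrite !invgM !invgK !mulgA; group_cancel.
Qed.

Lemma conj_through y b k n b2 :
  (y ^ n) ^ b2^-1 = ((y ^ b^-1) ^ k) ^ (k^-1 * b * n * b2^-1).
Proof. by rewrite -!conjgM !mulgA mulgK mulVg mul1g. Qed.

(** Inversion exchanges the roles of B and C. *)
Lemma swap_sides a b c f g x :
  a = b * f * x * g^-1 * c^-1 -> a^-1 = c * g * x^-1 * f^-1 * b^-1.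
Proof. by move=> ->; rewrite !invgM !invgK !mulgA. Qed.

End GroupIdentities.

Section CanonicalSubgraph.
Variables (A B C : gog) (muB : mor B A) (muC : mor C A).
Hypotheses (muB_imm : is_immersion muB) (muC_imm : is_immersion muC).
Let R := rawgog muB muC.
Variables (kb : forall p : R, VG (rv p)) (kc : forall p : R, VG (rw p)).
Definition canV (p : R) : R := rmove (kb p) (kc p).
Hypothesis canV_sim : forall p q : R, vsim p q -> canV p = canV q.
Variable PE : allE R -> Prop.
Hypothesis PE_einv : forall (p q : R) (s : edge p q),
  PE (tot s) -> PE (tot (einv s)).
Hypothesis PE_ex : forall (p q : R) (s : edge p q), exists s' : edge p q,
  esim s s' /\ PE (tot s').
Hypothesis PE_uniq : forall (p q : R) (s s' : edge p q), esim s s' ->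
  PE (tot s) -> PE (tot s') -> s = s'.

Lemma canV_vsim (p : R) : vsim p (canV p).
Proof. by exists (kb p), (kc p). Qed.

Lemma canV_idem (p : R) : canV (canV p) = canV p.
Proof. by rewrite -(canV_sim (canV_vsim p)). Qed.

Definition canQ : gog := subgog (fun p : R => canV p = p) PE_einv.
Definition canI : mor canQ R := incl (fun p : R => canV p = p) PE_einv.

(** If x moves within its double coset, so does the element a at the terminus:
    the elements of the edge groups pass to the vertex groups by omega. *)
Lemma edge_move (p q q2 : R) (s : redge p q) (s2 : redge p q2) n m :
  out (rf s) = out (rf s2) -> out (rg s) = out (rg s2) ->
  alpha (re s2) (rx s2) =
    alpha (re s) ((fehom (rhf s) n)^-1 * rx s * fehom (rhg s) m) ->
  vsim q q2.
Proof.
move=> fE gE.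
have vE : rv q = rv q2 := congr1 (@projT1 _ _) fE.
have wE : rw q = rw q2 := congr1 (@projT1 _ _) gE.
case: q q2 vE wE s s2 n m fE gE => [u v w hv hw a] [u2 v2 w2 hv2 hw2 a2] /= ? ?.
subst v2 w2 u u2; rewrite (Prop_irrelevance hw2 hw) => {hw2}.
case=> /= e f g hf hg x b c b' c' P P'.
case=> /= e1 f1 g1 hf1 hg1 x1 b1 c1 b1' c1' P1 P1' n m /out_inj ? /out_inj ?.
subst f1 g1; have ? : e = e1 by apply: tot_inj; rewrite -hf.
subst e1 => /alpha_inj xE.
exists (b' * omega f n * b1'^-1), (c' * omega g m * c1'^-1).
congr RVert; move: xE (fehom_omega hf erefl n) (fehom_omega hg hw m) => /=.
set N := ec hf _; set M := ec hg _ => xE omB omC.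
rewrite P1' P' xE !gmulfM !gmulfV omB omC !conjgE.
by rewrite !invgM !invgK !mulgA; group_cancel.
Qed.

Lemma canQ_out (p q q2 : canQ) (s : edge p q) (s2 : edge p q2) n m :
  out (rf (sval s)) = out (rf (sval s2)) ->
  out (rg (sval s)) = out (rg (sval s2)) ->
  alpha (re (sval s2)) (rx (sval s2)) =
    alpha (re (sval s)) ((fehom (rhf (sval s)) n)^-1 * rx (sval s) * fehom (rhg (sval s)) m) ->
  out s = out s2.
Proof.
move=> fE gE xE; have := edge_move fE gE xE => /canV_sim qE.
have ? : q = q2 by apply: sval_inj; rewrite -(svalP q) -(svalP q2).
subst q2; suff -> : s = s2 by [].
apply: sval_inj; apply: PE_uniq; [|exact: (svalP s)|exact: (svalP s2)].
by split; [exact: out_inj fE|exact: out_inj gE|exists n, m].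
Qed.

Definition canB : mor canQ B := mcomp (rawB muB muC) canI.
Definition canC : mor canQ C := mcomp (rawC muB muC) canI.

(** The first condition for [canB]: edges with the same double coset over B have
    the same C-component, because muC is an immersion, and equivalent x. *)
Lemma foldB (p q q2 : R) (s : redge p q) (s2 : redge p q2) (y : rVG p) n :
  out (rf s) = out (rf s2) -> rbo s2 = fib1 y * rbo s * alpha (rf s) n ->
  out (rg s) = out (rg s2) /\ exists m, alpha (re s2) (rx s2) =
    alpha (re s) ((fehom (rhf s) n)^-1 * rx s * fehom (rhg s) m).
Proof.
move=> fE bE.
have fE' : tot (emap muB (rf s)) = tot (emap muB (rf s2)).
  exact: (f_equal (fun t : outE (rv p) => tot (emap muB (projT2 t))) fE).
have eE : tot (re s2) = tot (re s) by rewrite -(rhf s2) -fE' (rhf s).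
have x2E : alpha (re s) (ec eE (rx s2)) = alpha (re s2) (rx s2).
  by rewrite (alpha_ec _ erefl) vc_id.
have tE : ftw (rhv p) (rf s2) = ftw (rhv p) (rf s).
  exact: esym (f_equal (fun t : outE (rv p) => ftw (rhv p) (projT2 t)) fE).
have P2 := rPo s2; rewrite tE -x2E in P2.
have b2E : fhom (rhv p) (rbo s2) = fhom (rhv p) y.1 * fhom (rhv p) (rbo s)
    * fhom (rhv p) (alpha (rf s) n) by rewrite bE !gmulfM.
have := transfer_twist (rPo s) P2 b2E (fehom_alpha (rhf s) (rhv p) n) (fib_eq y).
set X := _^-1 * _ * _ => gE.
have {X gE}gE : ftw (rhw p) (rg s2) =
    fhom (rhw p) ((rco s2)^-1 * y.2 * rco s) * ftw (rhw p) (rg s)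
    * alpha (re s) ((rx s)^-1 * fehom (rhf s) n * ec eE (rx s2)).
  by rewrite gE /X !gmulfM !gmulfV.
have hg2 : tot (emap muC (rg s2)) = tot (re s) by rewrite (rhg s2).
have gE' := frame_fold muC_imm (rhg s) hg2 gE.
have tgE : ftw (rhw p) (rg s2) = ftw (rhw p) (rg s).
  exact: esym (f_equal (fun t : outE (rw p) => ftw (rhw p) (projT2 t)) gE').
split=> //; move: gE; rewrite tgE; set X := _ * _ * ec _ _; set c := _ * rco s => gE.
have cE : fhom (rhw p) c ^ ftw (rhw p) (rg s) = alpha (re s) X^-1.
  rewrite gmulfV; apply: (mulIg (alpha (re s) X)); rewrite mulVg conjgE.
  by rewrite -!mulgA [_ c * _]mulgA -gE mulVg.
have [m _ mE] := frame_edge_group muC_imm (rhg s) cE.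
exists m^-1; rewrite -x2E; congr (alpha (re s) _).
by rewrite (gmulfV (fehom _)) mE /X !invgM !invgK !mulgA; group_cancel.
Qed.

Lemma foldC (p q q2 : R) (s : redge p q) (s2 : redge p q2) (y : rVG p) m :
  out (rg s) = out (rg s2) -> rco s2 = fib2 y * rco s * alpha (rg s) m ->
  out (rf s) = out (rf s2) /\ exists n, alpha (re s2) (rx s2) =
    alpha (re s) ((fehom (rhf s) n)^-1 * rx s * fehom (rhg s) m).
Proof.
move=> gE cE.
have gE' : tot (emap muC (rg s)) = tot (emap muC (rg s2)).
  exact: (f_equal (fun t : outE (rw p) => tot (emap muC (projT2 t))) gE).
have eE : tot (re s2) = tot (re s) by rewrite -(rhg s2) -gE' (rhg s).
have x2E : alpha (re s) (ec eE (rx s2)) = alpha (re s2) (rx s2).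
  by rewrite (alpha_ec _ erefl) vc_id.
have tE : ftw (rhw p) (rg s2) = ftw (rhw p) (rg s).
  exact: esym (f_equal (fun t : outE (rw p) => ftw (rhw p) (projT2 t)) gE).
have P2 := rPo s2; rewrite tE -x2E in P2.
have c2E : fhom (rhw p) (rco s2) = fhom (rhw p) y.2 * fhom (rhw p) (rco s)
    * fhom (rhw p) (alpha (rg s) m) by rewrite cE !gmulfM.
have yE : fhom (rhv p) y.1 = fhom (rhw p) y.2 ^ (ra p)^-1 by rewrite fib_eq conjgK.
have := transfer_twist (swap_sides (rPo s)) (swap_sides P2) c2E
  (fehom_alpha (rhg s) (rhw p) m) yE.
set X := _^-1^-1 * _ * _ => fE.
have {X fE}fE : ftw (rhv p) (rf s2) =
    fhom (rhv p) ((rbo s2)^-1 * y.1 * rbo s) * ftw (rhv p) (rf s)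
    * alpha (re s) (rx s * fehom (rhg s) m * (ec eE (rx s2))^-1).
  by rewrite fE /X !gmulfM !gmulfV invgK.
have hf2 : tot (emap muB (rf s2)) = tot (re s) by rewrite (rhf s2).
have fE' := frame_fold muB_imm (rhf s) hf2 fE.
have tfE : ftw (rhv p) (rf s2) = ftw (rhv p) (rf s).
  exact: esym (f_equal (fun t : outE (rv p) => ftw (rhv p) (projT2 t)) fE').
split=> //; move: fE; rewrite tfE; set X := _ * (ec _ _)^-1; set c := _ * rbo s => fE.
have bE : fhom (rhv p) c ^ ftw (rhv p) (rf s) = alpha (re s) X^-1.
  rewrite gmulfV; apply: (mulIg (alpha (re s) X)); rewrite mulVg conjgE.
  by rewrite -!mulgA [_ c * _]mulgA -fE mulVg.
have [n _ nE] := frame_edge_group muB_imm (rhf s) bE.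
exists n^-1; rewrite -x2E; congr (alpha (re s) _).
by rewrite (gmulfV (fehom _)) nE /X !invgM !invgK !mulgA; group_cancel.
Qed.

(** The second condition for [canB]: the C-component of y is in the edge group
    because its image in A is the conjugate by x of the B-component. *)
Lemma edge_groupB (p q : R) (s : redge p q) (y : rVG p) n :
  fib1 y ^ rbo s = alpha (rf s) n -> exists t, ralpha s t = y.
Proof.
move=> bE; have NE : alpha (re s) (fehom (rhf s) n) =
    (fhom (rhv p) y.1 ^ fhom (rhv p) (rbo s)) ^ ftw (rhv p) (rf s).
  by rewrite (fehom_alpha _ (rhv p)) -bE !(gmulfJ (fhom _)).
have := transfer_conj (rPo s) (fib_eq y) NE.
rewrite -(gmulfJ (fhom _)) -(gmulfJ (alpha _)) => cE.
have [m mE mX] := frame_edge_group muC_imm (rhg s) cE.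
exists (mkfib mX : rEG s); apply: fib_ext; rewrite /= /conj_by /=.
  by rewrite -bE conjgK.
by rewrite mE conjgK.
Qed.

Lemma edge_groupC (p q : R) (s : redge p q) (y : rVG p) m :
  fib2 y ^ rco s = alpha (rg s) m -> exists t, ralpha s t = y.
Proof.
move=> cE; have ME : alpha (re s) (fehom (rhg s) m) =
    (fhom (rhw p) y.2 ^ fhom (rhw p) (rco s)) ^ ftw (rhw p) (rg s).
  by rewrite (fehom_alpha _ (rhw p)) -cE !(gmulfJ (fhom _)).
have yE : fhom (rhv p) y.1 = fhom (rhw p) y.2 ^ (ra p)^-1 by rewrite fib_eq conjgK.
have := transfer_conj (swap_sides (rPo s)) yE ME.
rewrite -(gmulfJ (fhom _)) -gmulfV -(gmulfJ (alpha _)) => bE.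
have [n nE nX] := frame_edge_group muB_imm (rhf s) bE.
have mX : fehom (rhg s) m = fehom (rhf s) n ^ rx s by rewrite nX conjgKV.
exists (mkfib mX : rEG s); apply: fib_ext; rewrite /= /conj_by /=.
  by rewrite nE conjgK.
by rewrite -cE conjgK.
Qed.

Lemma canB_immersion : is_immersion canB.
Proof.
apply: immersionI => [p q q2 s s2 y n /= fE|p q s y n] /=; rewrite !mul1g => bE.
  have [gE [m xE]] := foldB (s := sval s) (s2 := sval s2) (y := y) fE bE.
  exact: canQ_out xE.
exact: edge_groupB bE.
Qed.

Lemma canC_immersion : is_immersion canC.
Proof.
apply: immersionI => [p q q2 s s2 y n /= fE|p q s y n] /=; rewrite !mul1g => bE.
  have [gE [m xE]] := foldC (s := sval s) (s2 := sval s2) (y := y) fE bE.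
  exact: canQ_out xE.
exact: edge_groupC bE.
Qed.

Lemma esimE (p q : R) (s s' : redge p q) : esim s s' ->
  exists n m b c bt ct P P', s' = @REdge _ _ _ _ _ p q (re s) (rf s) (rg s)
    (rhf s) (rhg s) ((fehom (rhf s) n)^-1 * rx s * fehom (rhg s) m) b c bt ct P P'.
Proof.
case: s' => [e1 f1 g1 hf1 hg1 x1 b1 c1 b1' c1' P1 P1'] [/= fE gE].
subst f1 g1; have ? : re s = e1 by apply: tot_inj; rewrite -(rhf s).
subst e1 => -[n [m /alpha_inj xE]]; subst x1.
exists n, m, b1, c1, b1', c1', P1, P1'.
by rewrite (Prop_irrelevance hf1 (rhf s)) (Prop_irrelevance hg1 (rhg s)).
Qed.

Lemma redge_to_reps_subproof (G : groupType) (a b c b1 c1 f x g : G) :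
  a = b * f * x * g^-1 * c^-1 ->
  b1^-1 * a * c1 = (b1^-1 * b) * f * x * g^-1 * (c1^-1 * c)^-1.
Proof. by move=> ->; rewrite invgM invgK !mulgA. Qed.

(** Moving the ends of an edge to their representatives changes beta and kappa
    only. *)
Definition redge_to_reps (p q : R) (s : redge p q) : redge (canV p) (canV q).
Proof.
refine (@REdge _ _ _ _ _ (canV p) (canV q) (re s) (rf s) (rg s) (rhf s) (rhg s)
  (rx s) ((kb p)^-1 * rbo s) ((kc p)^-1 * rco s)
  ((kb q)^-1 * rbt s) ((kc q)^-1 * rct s) _ _).
- rewrite !gmulfM !gmulfV.
  exact: redge_to_reps_subproof (rPo s).
- rewrite !gmulfM !gmulfV.
  exact: redge_to_reps_subproof (rPt s).
Defined.

(** A way of passing from the edge s to an edge between the representatives of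
    its ends, which is [rwit_edge]: elements n, m with new x = n^-1 x m, and new
    beta, kappa.  The pair (n, m) is not determined by the new edge. *)
Record rwit (p q : R) (s : redge p q) := RWit {
  wn : EG (rf s); wm : EG (rg s);
  wb : VG (rv p); wc : VG (rw p); wbt : VG (rv q); wct : VG (rw q);
  wPo : ra (canV p) = fhom (rhv p) wb * ftw (rhv p) (rf s)
    * alpha (re s) ((fehom (rhf s) wn)^-1 * rx s * fehom (rhg s) wm)
    * (ftw (rhw p) (rg s))^-1 * (fhom (rhw p) wc)^-1;
  wPt : ra (canV q) = fhom (rhv q) wbt * ftw (rhv q) (einv (rf s))
    * omega (re s) ((fehom (rhf s) wn)^-1 * rx s * fehom (rhg s) wm)
    * (ftw (rhw q) (einv (rg s)))^-1 * (fhom (rhw q) wct)^-1 }.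

Definition rwit_edge (p q : R) (s : redge p q) (w : rwit s) : redge (canV p) (canV q) :=
  @REdge _ _ _ _ _ (canV p) (canV q) (re s) (rf s) (rg s) (rhf s) (rhg s)
    ((fehom (rhf s) (wn w))^-1 * rx s * fehom (rhg s) (wm w))
    (wb w) (wc w) (wbt w) (wct w) (wPo w) (wPt w).

(** Since n and m serve as conjugating elements of the retraction at both ends of
    s, those of the inverse edge must be their images under inversion. *)
Definition wflip (p q : R) (s : redge p q) (s' : redge q p)
    (w : rwit s) (w' : rwit s') : Prop :=
  [/\ PE (@tot R _ _ (rwit_edge w)), rwit_edge w' = rinv (rwit_edge w),
      alpha (rf s') (wn w') = omega (rf s) (wn w)
      /\ omega (rf s') (wn w') = alpha (rf s) (wn w) &
      alpha (rg s') (wm w') = omega (rg s) (wm w)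
      /\ omega (rg s') (wm w') = alpha (rg s) (wm w)].

Lemma wflip_sym (p q : R) (s : redge p q) (s' : redge q p)
    (w : rwit s) (w' : rwit s') : wflip w w' -> wflip w' w.
Proof.
move=> [cw hE [n1 n2] [m1 m2]]; split=> //.
- by rewrite hE; apply: (PE_einv cw).
- by rewrite hE rinvK.
Qed.

Lemma wflip_ex (p q : R) (s : redge p q) :
  exists (w : rwit s) (w' : rwit (rinv s)), wflip w w'.
Proof.
have [s' [/esimE[n [m [b [c [bt [ct [P [P' ->]]]]]]]] cs']] := PE_ex (redge_to_reps s : @edge R _ _).
pose w := @RWit p q s n m b c bt ct P P'.
have xE : (fehom (rhf (rinv s)) (eflip n))^-1 * rx (rinv s)
    * fehom (rhg (rinv s)) (eflip m) =
    eflip ((fehom (rhf s) n)^-1 * rx s * fehom (rhg s) m).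
  apply: (alpha_inj (einv (re s))).
  rewrite (fehom_flip (rhf s) _ (rhv q)) (fehom_flip (rhg s) _ (rhw q)).
  by rewrite !gmulfM gmulfV !alpha_flip !gmulfM gmulfV.
have [w' hE [nE mE]] : exists2 w' : rwit (rinv s), rwit_edge w' = rinv (rwit_edge w) &
    wn w' = eflip n /\ wm w' = eflip m.
  unshelve eexists (@RWit q p (rinv s) (eflip n) (eflip m) bt ct b c _ _) => //.
  - by rewrite xE alpha_flip.
  - by rewrite xE omega_flip !einvK.
  - by apply: redge_ext => //; congr (alpha _ _).
exists w, w'; split=> //.
  by rewrite nE alpha_flip omega_flip.
by rewrite mE alpha_flip omega_flip.
Qed.

Section Retraction.
Variable w : forall (p q : R) (s : redge p q), rwit s.
Hypothesis wP : forall (p q : R) (s : redge p q), wflip (w s) (w (rinv s)).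

Definition retr_vmap (p : R) : canQ := exist _ (canV p) (canV_idem p).

Lemma rwit_edge_canonical (p q : R) (s : redge p q) : PE (@tot R _ _ (rwit_edge (w s))).
Proof. by case: (wP s). Qed.

Definition retr_emap (p q : R) (s : @edge R p q) :
    @edge canQ (retr_vmap p) (retr_vmap q) :=
  exist (fun t : @edge R (canV p) (canV q) => PE (tot t)) (rwit_edge (w s))
    (rwit_edge_canonical s).

Lemma retr_emapV (p q : R) (s : @edge R p q) :
  retr_emap (einv s) = einv (retr_emap s).
Proof. by apply: sval_inj; case: (wP s). Qed.

Lemma retr_vhomP (p : R) (y : rVG p) :
  fhom (rhw (canV p)) ((conj_by (kc p) \o fib2) y)
  = fhom (rhv (canV p)) ((conj_by (kb p) \o fib1) y) ^ ra (canV p).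
Proof.
rewrite [LHS](gmulfJ (fhom _)) [in RHS](gmulfJ (fhom _)) -[LHS]/(fhom (rhw p) y.2 ^ _).
by rewrite fib_eq -!conjgM !mulgA mulgV mul1g.
Qed.

Lemma retr_ehomP (p q : R) (s : redge p q) (y : rEG s) :
  fehom (rhg (rwit_edge (w s))) ((conj_by (wm (w s)) \o fib2) y)
  = fehom (rhf (rwit_edge (w s))) ((conj_by (wn (w s)) \o fib1) y) ^ rx (rwit_edge (w s)).
Proof.
rewrite [LHS](gmulfJ (fehom _)) [in RHS](gmulfJ (fehom _)) -[LHS]/(fehom (rhg s) y.2 ^ _).
by rewrite fib_eq -!conjgM !mulgA mulgV mul1g.
Qed.

Lemma retr_twistP (p q : R) (s : redge p q) :
  fhom (rhw p) ((kc p)^-1 * rco s * alpha (rg s) (wm (w s)) * (wc (w s))^-1)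
  = fhom (rhv p) ((kb p)^-1 * rbo s * alpha (rf s) (wn (w s)) * (wb (w s))^-1)
    ^ ra (canV p).
Proof.
have := wPo (w s); rewrite !gmulfM gmulfV => P.
have := transfer_fiber (rPo s) P (fehom_alpha (rhf s) (rhv p) (wn (w s)))
  (fehom_alpha (rhg s) (rhw p) (wm (w s))).
by rewrite !gmulfV.
Qed.

Definition retr_twist (p q : R) (s : @edge R p q) : rVG (canV p) :=
  mkfib (retr_twistP s).

Definition retr_data : mor_data (GraphMor retr_emapV : graph_mor R canQ).
Proof.
refine (@MorData R canQ (GraphMor retr_emapV)
  (fun p => fib_hom (@retr_vhomP p) : ghom (rVG p) (rVG (canV p)))
  (fun p q s => fib_hom (@retr_ehomP p q s) : ghom (rEG s) (rEG (rwit_edge (w s))))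
  _ _ retr_twist _ _).
- move=> p y y' E; apply: fib_ext.
    exact: (@conjg_inj _ (kb p) _ _ (congr1 fib1 E)).
  exact: (@conjg_inj _ (kc p) _ _ (congr1 fib2 E)).
- move=> p q s y y' E; apply: fib_ext.
    exact: (@conjg_inj _ (wn (w s)) _ _ (congr1 fib1 E)).
  exact: (@conjg_inj _ (wm (w s)) _ _ (congr1 fib2 E)).
- move=> p q s y; apply: fib_ext; rewrite /= /conj_by /= gmulfJ;
    exact: conj_through.
- move=> p q s y; have [_ hE [nE _] [mE _]] := wP s.
  have bE : wb (w (rinv s)) = wbt (w s) := congr1 (@rbo _ _ _ _ _ _ _) hE.
  have cE : wc (w (rinv s)) = wct (w s) := congr1 (@rco _ _ _ _ _ _ _) hE.
  apply: fib_ext; rewrite /= /conj_by /= gmulfJ ?nE ?mE ?bE ?cE;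
    exact: conj_through.
Defined.

Definition retr : mor R canQ := Mor retr_data.

Lemma retrB : approx (mcomp canB retr) (rawB muB muC).
Proof.
apply: approx_sym.
apply: (@approx_over _ _ (rawB muB muC) (mcomp canB retr) (rawB muB muC)
  (fun=> erefl) (fun=> erefl) kb (fun p q s => wn (w s))) => //.
split=> // p q s /=; rewrite mul1g.
  by rewrite /fib1 /= mulgVK !invgM !invgK !mulgA mulgK mulgV mul1g.
have [_ _ [/= nE _] _] := wP s.
by rewrite /fib1 /= nE mulgVK !invgM !invgK !mulgA mulgK mulgV mul1g.
Qed.

Lemma retrC : approx (mcomp canC retr) (rawC muB muC).
Proof.
apply: approx_sym.
apply: (@approx_over _ _ (rawC muB muC) (mcomp canC retr) (rawC muB muC)
  (fun=> erefl) (fun=> erefl) kc (fun p q s => wm (w s))) => //.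
split=> // p q s /=; rewrite mul1g.
  by rewrite /fib2 /= mulgVK !invgM !invgK !mulgA mulgK mulgV mul1g.
have [_ _ _ [/= mE _]] := wP s.
by rewrite /fib2 /= mE mulgVK !invgM !invgK !mulgA mulgK mulgV mul1g.
Qed.

End Retraction.

Lemma retraction : exists r : mor R canQ,
  approx (mcomp canB r) (rawB muB muC) /\ approx (mcomp canC r) (rawC muB muC).
Proof.
have [|w wP] := @coherent_choice R (fun p q s => rwit (s : redge p q))
  (fun p q s s' w w' => wflip w w') (fun p q s s' w w' => @wflip_sym p q s s' w w').
  exact: wflip_ex.
by exists (retr wP); split; [apply: retrB|apply: retrC].
Qed.

End CanonicalSubgraph.

(** * Uniqueness and the pullback *)

(** The composite of four equivalences around the square formed by s, s' and the
    two projections, in the group at one end of an edge: primes refer to s', the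
    elements B and C to the equivalences over the two projections.  The result
    has again the form of an equivalence, with edge element N^-1 x' M x^-1. *)
Lemma twisted_square (G : groupType) (a a' b b' c c' f g x x' t t' u u' n m N M : G)
    (B C : G) :
  a = b * f * x * g^-1 * c^-1 -> a' = b' * f * x' * g^-1 * c'^-1 ->
  B = t' * b' * n * (t * b)^-1 -> C = u' * c' * m * (u * c)^-1 ->
  N = n ^ f -> M = m ^ g -> u = t ^ a -> u' = t' ^ a' ->
  B^-1 * a' * C * a^-1
  = (t * b * f) * (N^-1 * x' * M * x^-1) * (t * b * f)^-1.
Proof.
move=> aE aE' -> -> -> -> -> ->; rewrite !conjgE.
rewrite !invgM !invgK !mulgA; group_cancel.
rewrite aE aE' !invgM !invgK !mulgA.
by group_cancel.
Qed.

(** The composite fixes the image of the vertex group of the source. *)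
Lemma twisted_fixed (G : groupType) (a a' y z t z' B C : G) :
  y = t ^ B -> z = z' ^ C -> z = y ^ a -> z' = t ^ a' ->
  y = y ^ (B^-1 * a' * C * a^-1).
Proof.
move=> yE zE zy zt; apply: (@conjg_inj _ a); rewrite -zy zE zt yE -!conjgM.
by rewrite !mulgA; group_cancel.
Qed.

Lemma conj_by_twist (G : groupType) (t' r n t : G) :
  t' * r * n * (t * r)^-1 = t' * conj_by r^-1 n * t^-1.
Proof. by rewrite /conj_by conjgE invgK invgM !mulgA. Qed.

Section Uniqueness.
Variables (A B C : gog) (muB : mor B A) (muC : mor C A).
Let R := rawgog muB muC.

Section Loop.
Variables (X : gog) (s s' : mor X R).
Variables (VB : forall x, rv (s' x) = rv (s x)) (VC : forall x, rw (s' x) = rw (s x)).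
Hypothesis EB : forall x y (f : edge x y),
  tot (rf (emap s' f)) = tot (rf (emap s f)).
Hypothesis EC : forall x y (f : edge x y),
  tot (rg (emap s' f)) = tot (rg (emap s f)).
Variables (b : forall x, VG (rv (s x))) (c : forall x, VG (rw (s x))).
Variables (bf : forall x y (f : edge x y), EG (rf (emap s f))).
Variables (cf : forall x y (f : edge x y), EG (rg (emap s f))).
Hypothesis HB : over (mu1 := mcomp (rawB muB muC) s') (mu2 := mcomp (rawB muB muC) s)
  (m := mcomp (rawB muB muC) s) VB (fun=> erefl) b bf.
Hypothesis HC : over (mu1 := mcomp (rawC muB muC) s') (mu2 := mcomp (rawC muB muC) s)
  (m := mcomp (rawC muB muC) s) VC (fun=> erefl) c cf.

Lemma loop_ru x : ru (s' x) = ru (s x).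
Proof. by rewrite -(rhv (s' x)) -(rhv (s x)) VB. Qed.

Lemma loop_re x y (f : edge x y) : tot (re (emap s' f)) = tot (re (emap s f)).
Proof.
rewrite -(rhf (emap s' f)) -(rhf (emap s f)).
exact: (f_equal (fun t : allE B => tot (emap muB (projT2 (projT2 t)))) (EB f)).
Qed.

(** The closed chain of equivalences: back from s to s' over B, along the element a
    of s', from s' to s over C, and back along the element a of s. *)
Definition loopV x : VG (ru (s x)) :=
  (fhom (rhv (s x)) (b x))^-1 * vc (loop_ru x) (ra (s' x))
  * fhom (rhw (s x)) (c x) * (ra (s x))^-1.

Definition loopE x y (f : edge x y) : EG (re (emap s f)) :=
  (fehom (rhf (emap s f)) (bf f))^-1 * ec (loop_re f) (rx (emap s' f))
  * fehom (rhg (emap s f)) (cf f) * (rx (emap s f))^-1.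

Lemma loop_over : over (mu1 := mcomp muB (mcomp (rawB muB muC) s))
  (mu2 := mcomp muB (mcomp (rawB muB muC) s)) (m := gcomp (rawA_graph muB muC) s)
  (fun x => rhv (s x)) (fun x => rhv (s x)) loopV loopE.
Proof.
case: HB HC => [B1 B2 B3] [C1 C2 C3]; split=> [x y|x y f|x y f].
- have b1 : fhom (rhv (s x)) (fib1 (vhom s x y)) =
      vc (loop_ru x) (fhom (rhv (s' x)) (fib1 (vhom s' x y))) ^ fhom (rhv (s x)) (b x).
    by rewrite -(fhom_vc (VB x) (rhv (s x))) -gmulfJ; congr (fhom _ _); apply: B1.
  have c1 : fhom (rhw (s x)) (fib2 (vhom s x y)) =
      vc (loop_ru x) (fhom (rhw (s' x)) (fib2 (vhom s' x y))) ^ fhom (rhw (s x)) (c x).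
    by rewrite -(fhom_vc (VC x) (rhw (s x))) -gmulfJ; congr (fhom _ _); apply: C1.
  apply: twisted_fixed b1 c1 (fib_eq (vhom s x y)) _.
  by rewrite -gmulfJ; congr (vc _ _); apply: (fib_eq (vhom s' x y)).
- have b2 : fhom (rhv (s x)) (b x) =
      vc (loop_ru x) (fhom (rhv (s' x)) (twist s' f).1)
      * vc (loop_ru x) (fhom (rhv (s' x)) (rbo (emap s' f)))
      * fhom (rhv (s x)) (alpha (rf (emap s f)) (bf f))
      * (fhom (rhv (s x)) (twist s f).1 * fhom (rhv (s x)) (rbo (emap s f)))^-1.
    rewrite -!(fhom_vc (VB x) (rhv (s x))) -!gmulfM -gmulfV -!gmulfM.
    congr (fhom _ _); exact: (B2 _ _ f).
  have c2 : fhom (rhw (s x)) (c x) =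
      vc (loop_ru x) (fhom (rhw (s' x)) (twist s' f).2)
      * vc (loop_ru x) (fhom (rhw (s' x)) (rco (emap s' f)))
      * fhom (rhw (s x)) (alpha (rg (emap s f)) (cf f))
      * (fhom (rhw (s x)) (twist s f).2 * fhom (rhw (s x)) (rco (emap s f)))^-1.
    rewrite -!(fhom_vc (VC x) (rhw (s x))) -!gmulfM -gmulfV -!gmulfM.
    congr (fhom _ _); exact: (C2 _ _ f).
  have P' := congr1 (vc (loop_ru x)) (rPo (emap s' f)).
  rewrite !gmulfM !gmulfV (ftw_vc (EB f) (rhv (s x))) (ftw_vc (EC f) (rhw (s x)))
    -(alpha_ec (loop_re f)) in P'.
  have tE := fib_eq (twist s f).
  have tE' := congr1 (vc (loop_ru x)) (fib_eq (twist s' f)).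
  rewrite gmulfJ in tE'.
  have := twisted_square (rPo (emap s f)) P' b2 c2
    (fehom_alpha (rhf (emap s f)) (rhv (s x)) (bf f))
    (fehom_alpha (rhg (emap s f)) (rhw (s x)) (cf f)) tE tE'.
  rewrite -[LHS]/(loopV x) => ->.
  have lE : alpha (re (emap s f)) (loopE f) =
      (alpha (re (emap s f)) (fehom (rhf (emap s f)) (bf f)))^-1
      * alpha (re (emap s f)) (ec (loop_re f) (rx (emap s' f)))
      * alpha (re (emap s f)) (fehom (rhg (emap s f)) (cf f))
      * (alpha (re (emap s f)) (rx (emap s f)))^-1.
    by rewrite !gmulfM !gmulfV.
  by rewrite -lE /= !gmulfM.
- have b2 : fhom (rhv (s y)) (b y) =
      vc (loop_ru y) (fhom (rhv (s' y)) (twist s' (einv f)).1)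
      * vc (loop_ru y) (fhom (rhv (s' y)) (rbt (emap s' f)))
      * fhom (rhv (s y)) (omega (rf (emap s f)) (bf f))
      * (fhom (rhv (s y)) (twist s (einv f)).1 * fhom (rhv (s y)) (rbt (emap s f)))^-1.
    rewrite -!(fhom_vc (VB y) (rhv (s y))) -!gmulfM -gmulfV -!gmulfM.
    by congr (fhom _ _); have := B3 _ _ f; rewrite /= !emapV.
  have c2 : fhom (rhw (s y)) (c y) =
      vc (loop_ru y) (fhom (rhw (s' y)) (twist s' (einv f)).2)
      * vc (loop_ru y) (fhom (rhw (s' y)) (rct (emap s' f)))
      * fhom (rhw (s y)) (omega (rg (emap s f)) (cf f))
      * (fhom (rhw (s y)) (twist s (einv f)).2 * fhom (rhw (s y)) (rct (emap s f)))^-1.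
    rewrite -!(fhom_vc (VC y) (rhw (s y))) -!gmulfM -gmulfV -!gmulfM.
    by congr (fhom _ _); have := C3 _ _ f; rewrite /= !emapV.
  have P' := congr1 (vc (loop_ru y)) (rPt (emap s' f)).
  rewrite !gmulfM !gmulfV (ftw_vc (tot_einv (EB f)) (rhv (s y)))
    (ftw_vc (tot_einv (EC f)) (rhw (s y))) -(omega_ec (loop_re f)) in P'.
  have tE := fib_eq (twist s (einv f)).
  have tE' := congr1 (vc (loop_ru y)) (fib_eq (twist s' (einv f))).
  rewrite gmulfJ in tE'.
  have := twisted_square (rPt (emap s f)) P' b2 c2
    (fehom_omega (rhf (emap s f)) (rhv (s y)) (bf f))
    (fehom_omega (rhg (emap s f)) (rhw (s y)) (cf f)) tE tE'.
  rewrite -[LHS]/(loopV y) => ->.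
  have lE : omega (re (emap s f)) (loopE f) =
      (omega (re (emap s f)) (fehom (rhf (emap s f)) (bf f)))^-1
      * omega (re (emap s f)) (ec (loop_re f) (rx (emap s' f)))
      * omega (re (emap s f)) (fehom (rhg (emap s f)) (cf f))
      * (omega (re (emap s f)) (rx (emap s f)))^-1.
    by rewrite !gmulfM !gmulfV.
  by rewrite -lE /= !emapV !gmulfM.
Qed.

Lemma loop_trivial k : is_core X -> k_acylindrical A k ->
  is_immersion (mcomp muB (mcomp (rawB muB muC) s)) ->
  (forall x, ra (s x) = (fhom (rhv (s x)) (b x))^-1 * vc (loop_ru x) (ra (s' x))
    * fhom (rhw (s x)) (c x)) /\
  (forall x y (f : edge x y), rx (emap s f) =
    (fehom (rhf (emap s f)) (bf f))^-1 * ec (loop_re f) (rx (emap s' f))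
    * fehom (rhg (emap s f)) (cf f)).
Proof.
move=> cX Ak imm.
have [|zV zE] := over_rigid cX Ak imm _ loop_over.
  by move=> x y f; apply: rhf.
split=> [x|x y f].
- by apply/esym/divg1_eq; apply: zV.
- by apply/esym/divg1_eq; apply: zE.
Qed.
End Loop.

Section InCanonical.
Variables (kb : forall p : R, VG (rv p)) (kc : forall p : R, VG (rw p)).
Hypothesis canV_sim : forall p q : R, vsim p q -> canV kb kc p = canV kb kc q.
Variable PE : allE R -> Prop.
Hypothesis PE_einv : forall (p q : R) (s : edge p q),
  PE (tot s) -> PE (tot (einv s)).
Hypothesis PE_uniq : forall (p q : R) (s s' : edge p q), esim s s' ->
  PE (tot s) -> PE (tot s') -> s = s'.
Let Q := canQ kb kc PE_einv.
Let I : mor Q R := canI kb kc PE_einv.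

Lemma vsim_of (p' p : R) (VB : rv p' = rv p) (VC : rw p' = rw p)
    (hu : ru p' = ru p) b c :
  ra p = (fhom (rhv p) b)^-1 * vc hu (ra p') * fhom (rhw p) c -> vsim p' p.
Proof.
case: p' p VB VC hu b c => [u' v' w' hv' hw' a'] [u v w hv hw a] /= ? ? hu b c.
subst v' w'; destruct hu; rewrite (Prop_irrelevance hv' hv) (Prop_irrelevance hw' hw).
by move=> ->; exists b, c.
Qed.

Lemma esim_of (p q : R) (s' s : redge p q) (he : tot (re s') = tot (re s)) n m :
  rf s' = rf s -> rg s' = rg s ->
  rx s = (fehom (rhf s) n)^-1 * ec he (rx s') * fehom (rhg s) m -> esim s' s.
Proof.
case: s' s he n m => [e1 f1 g1 hf1 hg1 x1 b1 c1 b1' c1' P1 P1'].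
case=> [e f g hf hg x b c b' c' P P'] /= he n m ? ?; subst f1 g1.
have ? := tot_inj he; subst e1 => xE.
split=> //; exists n, m; rewrite /= xE ec_id.
by rewrite (Prop_irrelevance hf1 hf) (Prop_irrelevance hg1 hg).
Qed.

Lemma canonical_edge_eq (p' q' p q : R) (s' : redge p' q') (s : redge p q)
    (he : tot (re s') = tot (re s)) n m : p' = p -> q' = q ->
  tot (rf s') = tot (rf s) -> tot (rg s') = tot (rg s) ->
  rx s = (fehom (rhf s) n)^-1 * ec he (rx s') * fehom (rhg s) m ->
  PE (@tot R _ _ s') -> PE (@tot R _ _ s) -> @tot R _ _ s' = @tot R _ _ s.
Proof.
move=> ? ?; subst p' q' => /tot_inj fE /tot_inj gE /(esim_of fE gE) H c' c.
by rewrite (PE_uniq H c' c).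
Qed.

(** By [loop_trivial] the vertices and edges of s and s' are equivalent, and as
    both are representatives they are equal.  The same equations then say that
    the elements over B and C form elements of the vertex and edge groups. *)
Lemma canonical_unique k (X : gog) (s s' : mor X Q) :
  is_core X -> k_acylindrical A k ->
  is_immersion (mcomp muB (mcomp (rawB muB muC) (mcomp I s))) ->
  approx (mcomp (rawB muB muC) (mcomp I s')) (mcomp (rawB muB muC) (mcomp I s)) ->
  approx (mcomp (rawC muB muC) (mcomp I s')) (mcomp (rawC muB muC) (mcomp I s)) ->
  approx s' s.
Proof.
move=> cX Ak imm /approx_overP[VB [EB [b [bf HB]]]] /approx_overP[VC [EC [c [cf HC]]]].
have [aE xE] := loop_trivial EB EC HB HC cX Ak imm.
have sE : mgr s' = mgr s.
  have V x : s' x = s x.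
    apply: sval_inj; rewrite -(svalP (s' x)) -(svalP (s x)); apply: canV_sim.
    exact (@vsim_of _ _ (VB x) (VC x) _ _ _ (aE x)).
  apply: graph_mor_ext => // x y f; apply: sub_tot.
  apply: canonical_edge_eq (congr1 sval (V x)) (congr1 sval (V y)) (EB x y f)
    (EC x y f) (xE x y f) _ _; [exact: svalP (emap s' f)|exact: svalP (emap s f)].
case: s s' sE {imm} VB EB b bf VC EC c cf HB HC aE xE => [m d] [m' d'] /= ?.
subst m' => VB EB b bf VC EC c cf [B1 B2 B3] [C1 C2 C3] aE xE.
have abE x : fhom (rhw (sval (m x))) (c x)
    = fhom (rhv (sval (m x))) (b x) ^ ra (sval (m x)).
  by rewrite conjgE {2}(aE x) vc_id !mulgA mulgK mulVg mul1g.
have xbE x y (f : edge x y) : fehom (rhg (sval (emap m f))) (cf x y f)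
    = fehom (rhf (sval (emap m f))) (bf x y f) ^ rx (sval (emap m f)).
  by rewrite conjgE {2}(xE x y f) ec_id !mulgA mulgK mulVg mul1g.
apply: (@approx_over _ _ (Mor d') (Mor d) m (fun=> erefl) (fun=> erefl)
  (fun x => mkfib (abE x)) (fun x y f => mkfib (xbE x y f))) => //.
split=> [x y|x y f|x y f].
- by apply: fib_ext; [have := B1 x y|have := C1 x y]; rewrite !vc_id; apply.
- by apply: fib_ext; [have := B2 x y f|have := C2 x y f];
    rewrite !vc_id /= !mulg1 => ->; exact: conj_by_twist.
- have bE : rbo (sval (emap m (einv f))) = rbt (sval (emap m f)) by rewrite emapV.
  have cE : rco (sval (emap m (einv f))) = rct (sval (emap m f)) by rewrite emapV.
  by apply: fib_ext; [have := B3 x y f|have := C3 x y f];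
    rewrite !vc_id /= !mulg1 ?bE ?cE => ->; exact: conj_by_twist.
Qed.

End InCanonical.

End Uniqueness.

Theorem theoremE (A B C : core_gog) (hA : acylindrical A)
    (muB : @arrow catK B A) (muC : @arrow catK C A) :
  exists (P : catK) (rhoB : arrow P B) (rhoC : arrow P C),
    is_pullback muB muC rhoB rhoC.
Proof.
have [k Ak] := hA.
have [kb [kc canV_sim]] := canonical_vertices muB muC.
have [PE [PE_einv PE_ex PE_uniq]] := canonical_edges muB muC.
pose Q := canQ kb kc PE_einv.
pose qB : mor Q B := canB kb kc PE_einv; pose qC : mor Q C := canC kb kc PE_einv.
have qB_imm : is_immersion qB := canB_immersion (immP muC) canV_sim PE_einv PE_uniq.
have qC_imm : is_immersion qC := canC_immersion (immP muB) canV_sim PE_einv PE_uniq.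
pose I : mor (coreX Q) Q := incl (@core_vertex Q) (@core_edge_einv Q).
have I_imm : is_immersion I by apply: incl_immersion.
exists (CoreGog (coreX_core Q)), (Immersion (mcomp_immersion qB_imm I_imm)),
  (Immersion (mcomp_immersion qC_imm I_imm)).
have qbc : approx (mcomp muB qB) (mcomp muC qC).
  apply: approx_trans (approx_compA _ _ _) _.
  apply: approx_trans (approx_compr _ (raw_comm muB muC)) _.
  exact/approx_sym/approx_compA.
split.
  apply: approx_trans (approx_compA _ _ _) _.
  apply: approx_trans (approx_compr _ qbc) _.
  exact/approx_sym/approx_compA.
move=> X sB sC /= sbc.
have [s0 [s0B s0C]] := raw_universal sbc.
have [r [rB rC]] := retraction canV_sim PE_einv PE_ex.
pose s1 : mor X Q := mcomp r s0.
have s1B : approx (mcomp qB s1) sB.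
  apply: approx_trans (approx_compA _ _ _) _.
  exact: approx_trans (approx_compr _ rB) s0B.
have s1C : approx (mcomp qC s1) sC.
  apply: approx_trans (approx_compA _ _ _) _.
  exact: approx_trans (approx_compr _ rC) s0C.
have s1_imm : is_immersion s1.
  exact: immersion_cancel (approx_immersion (approx_sym s1B) (immP sB)).
have [cXV cXE] := cgogP X.
pose t : mor X (coreX Q) := factor (@core_edge_einv Q)
  (fun x => core_vertex_map s1_imm (cXV x)) (fun x y f => core_edge_map s1_imm (cXE (tot f))).
have tI : approx (mcomp I t) s1 by apply: incl_factor.
have t_imm : is_immersion t.
  exact: immersion_cancel (approx_immersion (approx_sym tI) s1_imm).
have tB : approx (mcomp (mcomp qB I) t) sB.
  apply: approx_trans (approx_sym (approx_compA _ _ _)) _.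
  exact: approx_trans (approx_compl _ tI) s1B.
have tC : approx (mcomp (mcomp qC I) t) sC.
  apply: approx_trans (approx_sym (approx_compA _ _ _)) _.
  exact: approx_trans (approx_compl _ tI) s1C.
exists (Immersion t_imm); split=> // t' tB' tC'.
apply: (@incl_mono Q (@core_vertex Q) (@core_edge Q) (@core_edge_einv Q)).
have raw_eq (D : gog) (q : mor (rawgog muB muC) D) :
    approx (mcomp (mcomp (mcomp q (canI kb kc PE_einv)) I) t')
           (mcomp (mcomp (mcomp q (canI kb kc PE_einv)) I) t) ->
    approx (mcomp q (mcomp (canI kb kc PE_einv) (mcomp I t')))
           (mcomp q (mcomp (canI kb kc PE_einv) (mcomp I t))).
  move=> H; apply: approx_trans (approx_compA _ _ _) _.
  apply: approx_trans (approx_compA _ _ _) _; apply: approx_trans H _.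
  apply: approx_trans (approx_sym (approx_compA _ _ _)) _.
  exact/approx_sym/approx_compA.
apply: (canonical_unique canV_sim PE_uniq (cgogP X) Ak).
- have H : approx (mcomp qB s1) (mcomp (rawB muB muC) (mcomp (canI kb kc PE_einv) (mcomp I t))).
    apply: approx_trans (approx_sym (approx_compA _ _ _)) _.
    by do 2!apply: approx_compl; apply: approx_sym.
  apply: mcomp_immersion (immP muB) _.
  exact: approx_immersion H (approx_immersion (approx_sym s1B) (immP sB)).
- exact/raw_eq/(approx_trans tB')/approx_sym.
- exact/raw_eq/(approx_trans tC')/approx_sym.
Qed.
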